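(* Let $K\ge1$, $N_r\ge K$, $\tau_p\ge1$, $\sigma_p^2,\sigma_d^2>0$, and for $k=1,\dots,K$ let $\alpha_k,P_k,P_{p,k},c_k>0$ and $a_k\in\mathbb{C}$ with $|a_k|<1$. Define $s_k=\frac{\sigma_p^2}{\alpha_k^2P_{p,k}\tau_p}$, $$\hat e_k=\frac{c_k(c_k+s_k-|a_k|^2c_k)}{(c_k+s_k)^2-|a_k|^2c_k^2},\quad \check e_k=\frac{a_kc_ks_k}{(c_k+s_k)^2-|a_k|^2c_k^2},\quad z_k=\frac{c_ks_k(c_k+s_k-|a_k|^2c_k)}{(c_k+s_k)^2-|a_k|^2c_k^2},$$ $\phi_k=\alpha_k^2P_k(\hat e_kc_k+\check e_kc_ka_k^* )$, $\phi=\phi_1$, and $\beta=\sum_{k=1}^K\alpha_k^2P_kz_k+\sigma_d^2$. Then (i) the equation $$\beta=\frac{N_r\phi}{\bar\gamma}-\sum_{k=2}^K\frac{\phi_k}{1+\bar\gamma\phi_k/\phi}$$ has a unique positive solution $\bar\gamma$; and (ii) if $\mathbf{b}\sim\mathcal{CN}(\mathbf{0},\phi\mathbf{I}_{N_r})$ and $\mathbf{b}_k\sim\mathcal{CN}(\mathbf{0},\phi_k\mathbf{I}_{N_r})$, $k=2,\dots,K$, are independent and $\gamma=\mathbf{b}^H\big(\sum_{k=2}^K\mathbf{b}_k\mathbf{b}_k^H+\beta\mathbf{I}_{N_r}\big)^{-1}\mathbf{b}$, then as $N_r\to\infty$ with $\limsup K/N_r<1$ and with all $\phi,\phi_k,\beta$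 confined to a fixed compact subset of $(0,\infty)$, $\frac1{N_r}(\gamma-\bar\gamma)\to0$ almost surely and $\frac1{N_r}(\mathbb{E}[\gamma]-\bar\gamma)\to0$; that is, $\bar\gamma$ is the asymptotic average SINR of the tagged user (user 1).
   Context: Setting: uplink MU-MIMO with $N_r$ BS antennas and $K$ single-antenna users, i.i.d. channel coefficients: for user $k$ the channel covariance is $c_k\mathbf{I}_{N_r}$, the AR(1) transition matrix is $a_k\mathbf{I}_{N_r}$, and the pilot estimation noise covariance is $s_k\mathbf{I}_{N_r}$. Then $\phi_k\mathbf{I}$ is the covariance of $\mathbf{b}_k=\alpha_k\sqrt{P_k}(\hat e_k\hat{\mathbf{h}}_k(t)+\check e_k\hat{\mathbf{h}}_k(t-1))$, $z_k\mathbf{I}$ is the channel estimation error covariance, and $\gamma$ is the instantaneous SINR under the MMSE receiver. $a^*$ denotes complex conjugate. *)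

(* Defs.v *)
(* mathcomp-analysis (probability) + mathcomp-real-closed (complex). *)
From HB Require Import structures.
From mathcomp Require Import all_boot all_order all_algebra.
From mathcomp Require Import all_classical all_reals all_analysis.
From mathcomp Require Import complex.
Set Implicit Arguments. Unset Strict Implicit. Unset Printing Implicit Defensive.
Import Order.TTheory GRing.Theory Num.Theory.
Local Open Scope classical_set_scope.
Local Open Scope ring_scope.
Local Open Scope complex_scope.

(* ---------- Part (i): system-model quantities (user k) ---------- *)
Section Model.
Variable R : realType.

(* s_k = sigma_p^2 / (alpha_k^2 P_{p,k} tau_p) *)
Definition s_k (sp2 alpha Pp : R) (taup : nat) : R :=
  sp2 / (alpha ^+ 2 * Pp * taup%:R).

(* common denominator (c+s)^2 - |a|^2 c^2  (computed in C) *)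
Definition den_k (c s : R) (a : R[i]) : R[i] :=
  ((c + s) ^+ 2)%:C - `|a| ^+ 2 * (c ^+ 2)%:C.

Definition ehat_k (c s : R) (a : R[i]) : R[i] :=
  c%:C * ((c + s)%:C - `|a| ^+ 2 * c%:C) / den_k c s a.

Definition echeck_k (c s : R) (a : R[i]) : R[i] :=
  a * (c * s)%:C / den_k c s a.

Definition z_k (c s : R) (a : R[i]) : R[i] :=
  (c * s)%:C * ((c + s)%:C - `|a| ^+ 2 * c%:C) / den_k c s a.

(* phi_k = alpha_k^2 P_k (ehat_k c_k + echeck_k c_k a_k^* ) *)
Definition phi_k (alpha P c s : R) (a : R[i]) : R[i] :=
  (alpha ^+ 2 * P)%:C * (ehat_k c s a * c%:C + echeck_k c s a * c%:C * a^*).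

End Model.

(* right-hand side of the fixed-point equation:
   N phi / g - sum_{x in s} x / (1 + g x / phi) *)
Definition sinr_rhs (F : fieldType) (N : nat) (phi : F) (s : seq F) (g : F) : F :=
  N%:R * phi / g - \sum_(x <- s) x / (1 + g * x / phi).

(* ---------- Part (ii): probabilistic notions ---------- *)

(* mutual independence of a finite family of real random variables:
   each is measurable, and the product rule holds for every subfamily J
   and every family of measurable sets. *)
Definition mutually_independent {d} {T : measurableType d} {R : realType}
    (P : probability T R) {I : finType} (X : I -> T -> R) : Prop :=
  (forall i, measurable_fun [set: T] (X i)) /\
  forall (J : {set I}) (B : I -> set R), (forall i, measurable (B i)) ->
    P (\bigcap_(i in [set j | j \in J]) (X i @^-1` B i)) =
    (\prod_(i in J) P (X i @^-1` B i))%E.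

(* conjugate transpose *)
Definition ctr {R : realType} m n (A : 'M[R[i]]_(m, n)) : 'M[R[i]]_(n, m) :=
  (map_mx (fun z => z^*) A)^T.

(* The real components (real and imaginary parts of all entries) of the
   vector b and of the vectors bs k, k < m, as one indexed family. *)
Definition cn_components {R : realType} {T : Type} (N m : nat)
    (b : T -> 'cV[R[i]]_N) (bs : 'I_m -> T -> 'cV[R[i]]_N) :
    ('I_N * bool) + ('I_m * 'I_N * bool) -> T -> R :=
  fun idx w => match idx with
  | inl (j, false) => complex.Re (b w j ord0)
  | inl (j, true) => complex.Im (b w j ord0)
  | inr (k, j, false) => complex.Re (bs k w j ord0)
  | inr (k, j, true) => complex.Im (bs k w j ord0)
  end.

(* variance of each real component: half of the complex variance *)
Definition cn_variance {R : realType} (N m : nat) (phi : R) (phis : 'I_m -> R)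
    (idx : ('I_N * bool) + ('I_m * 'I_N * bool)) : R :=
  match idx with
  | inl _ => phi / 2
  | inr (k, _, _) => phis k / 2
  end.

(* b ~ CN(0, phi I_N), bs k ~ CN(0, phis k I_N), all independent:
   all real components are mutually independent, centred real Gaussians
   with variance (complex variance)/2. *)
Definition CN_model {d} {T : measurableType d} {R : realType}
    (P : probability T R) (N m : nat) (phi : R) (phis : 'I_m -> R)
    (b : T -> 'cV[R[i]]_N) (bs : 'I_m -> T -> 'cV[R[i]]_N) : Prop :=
  mutually_independent P (cn_components b bs) /\
  forall idx (B : set R), measurable B ->
    P (cn_components b bs idx @^-1` B) =
    normal_prob 0 (Num.sqrt (cn_variance phi phis idx)) B.

(* gamma = b^H (sum_k bs_k bs_k^H + beta I)^{-1} b *)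
Definition sinr_mmse {R : realType} (N m : nat) (beta : R)
    (b : 'cV[R[i]]_N) (bs : 'I_m -> 'cV[R[i]]_N) : R[i] :=
  (ctr b *m invmx (\sum_(k < m) bs k *m ctr (bs k) + (beta%:C)%:M) *m b) ord0 ord0.

(* complex modulus, real-valued *)
Definition cmod {R : realType} (z : R[i]) : R := Num.sqrt (complex.Re z ^+ 2 + complex.Im z ^+ 2).

(* Main.v *)
(** Write [A] for the sum of the [b_k b_k^H] plus [beta I], [m] for the number of
    interferers and [D = gamma - phi tr A^-1].  Taking the trace of [A A^-1 = I] and
    applying the Sherman-Morrison formula gives
    [beta tr A^-1 = N - m + sum_k 1 / (1 + gamma_k)], where [gamma_k] is the SINR of
    user [k] against the other interferers.  Since the [b_k] are not normalised by [N],
    [gamma_k] is of order [N] up to its own deviation [D_k], so the last sum is bounded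
    up to terms [(D_k / N)^4], and [gamma / N] is close to [phi (N - m) / (beta N)].
    The fixed-point equation reads
    [beta gbar = (N - m) phi + phi sum_k 1 / (1 + gbar phi_k / phi)], hence [gbar / N] has
    the same asymptotics.  Given the other users, [D] is a centred Gaussian quadratic form,
    whose fourth moment is [O(N^2)] by a martingale argument in the real coordinates; this
    makes [(D / N)^4] and the average of the [(D_k / N)^4] summable in mean, which yields
    both the almost sure and the mean convergence. *)
Require Import Defs.
From HB Require Import structures.
From mathcomp Require Import all_boot all_order all_algebra.
From mathcomp Require Import all_classical all_reals all_analysis.
From mathcomp Require Import measurable_realfun complex ring lra.
Import Order.TTheory GRing.Theory Num.Theory numFieldNormedType.Exports.
Set Implicit Arguments. Unset Strict Implicit. Unset Printing Implicit Defensive.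
Local Open Scope classical_set_scope.
Local Open Scope ring_scope.

(** * Random variables with all moments *)

(** The almost sure limit comes from summing means over [N], and this dictates the fourth moment:
    the second moment of [D / N] is only of order [1 / N], which is not summable, while the fourth
    is of order [N^-2]. To reach that order with a random matrix [A^-1], the estimate uses only its
    squared row norms, which are at most [beta^-2] whatever [N] is and whatever the interferers are.

    No conditional expectation is formed. It is replaced by the independence of one real coordinate
    from the sigma-algebra of all the others: the coefficients of the form, and every partial sum
    that omits a coordinate, are measurable for that sigma-algebra, so each mean factors.

    The bound on [K / N] away from [1] keeps [tr A^-1] of order [N], for the full matrix and for
    each matrix with one user removed. This forces the [gamma_k] and [gbar] to be of order [N], and
    makes both sums of inverses negligible. *)

Section AllMoments.
Context {d} {T : measurableType d} {R : realType} (P : probability T R).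
Implicit Types X Y : T -> R.

(** Even powers avoid absolute values. The class is an algebra containing the bounded and the
    Gaussian variables, so integrability goals are settled by following the shape of an
    expression. *)
Definition all_moments Y := measurable_fun [set: T] Y /\
  forall k, P.-integrable [set: T] (fun w => (Y w ^+ (2 * k))%:E).

Definition Ex Y : R := (\int[P]_w Y w)%R.

Lemma integrable_dominated X Y : measurable_fun [set: T] X ->
  P.-integrable [set: T] (fun w => (Y w)%:E) -> (forall w, `|X w| <= Y w) ->
  P.-integrable [set: T] (fun w => (X w)%:E).
Proof.
move=> mX iY XY; apply: (le_integrable measurableT _ _ iY).
  exact/measurable_EFinP.
by move=> w _ /=; rewrite lee_fin (le_trans (XY w))// ler_norm.
Qed.

Lemma all_moments_bounded Y (C : R) : measurable_fun [set: T] Y ->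
  (forall w, `|Y w| <= C) -> all_moments Y.
Proof.
move=> mY YC; split=> // k.
apply: (@integrable_dominated _ (fun=> C ^+ (2 * k))).
- exact: measurable_funX.
- exact: finite_measure_integrable_cst.
- by move=> w; rewrite normrX; apply: lerXn2r; rewrite ?nnegrE// (le_trans _ (YC w)).
Qed.

Lemma all_moments_cst (c : R) : all_moments (fun=> c).
Proof. exact: (@all_moments_bounded _ `|c|). Qed.

Lemma all_momentsD X Y : all_moments X -> all_moments Y ->
  all_moments (fun w => X w + Y w).
Proof.
move=> [mX iX] [mY iY]; split=> [|k]; first exact: measurable_funD.
apply: (@integrable_dominated _
  (fun w => (2 ^+ (2 * k)) * (X w ^+ (2 * k) + Y w ^+ (2 * k)))).
- by apply: measurable_funX; exact: measurable_funD.
- under eq_fun do rewrite EFinM.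
  by apply: integrableZl => //; under eq_fun do rewrite EFinD; exact: integrableD.
move=> w; rewrite normrX.
have nX : `|X w| ^+ (2 * k) = X w ^+ (2 * k).
  by rewrite !exprM -normrX ger0_norm// sqr_ge0.
have nY : `|Y w| ^+ (2 * k) = Y w ^+ (2 * k).
  by rewrite !exprM -normrX ger0_norm// sqr_ge0.
(* When [a <= b] the sum is at most [2 * b]; the two possible orders of [|X w|] and [|Y w|] are
   treated at the end. *)
have h (a b : R) : 0 <= a -> 0 <= b -> a <= b ->
    (a + b) ^+ (2 * k) <= 2 ^+ (2 * k) * (a ^+ (2 * k) + b ^+ (2 * k)).
  move=> a0 b0 ab; apply: (@le_trans _ _ ((2 * b) ^+ (2 * k))).
    by apply: lerXn2r; rewrite ?nnegrE ?addr_ge0 ?mulr_ge0//; lra.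
  rewrite exprMn; apply: ler_wpM2l; first by rewrite exprn_ge0.
  by rewrite lerDr exprn_ge0.
rewrite -nX -nY; apply: (@le_trans _ _ ((`|X w| + `|Y w|) ^+ (2 * k))).
  by apply: lerXn2r; rewrite ?nnegrE ?addr_ge0// ler_normD.
have [XY|/ltW XY] := leP `|X w| `|Y w|; first exact: h.
by rewrite addrC [X in _ * X]addrC; exact: h.
Qed.

(** From [a * b <= a^2 + b^2] for the powers of order [2 k]: moments of order [4 k] of the factors
    are enough. *)
Lemma all_momentsM X Y : all_moments X -> all_moments Y ->
  all_moments (fun w => X w * Y w).
Proof.
move=> [mX iX] [mY iY]; split=> [|k]; first exact: measurable_funM.
apply: (@integrable_dominated _
  (fun w => X w ^+ (2 * (2 * k)) + Y w ^+ (2 * (2 * k)))).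
- by apply: measurable_funX; exact: measurable_funM.
- by under eq_fun do rewrite EFinD; exact: integrableD.
move=> w; rewrite exprMn.
rewrite (_ : 2 * (2 * k) = 2 * k + 2 * k)%N; last by rewrite addnn mul2n.
rewrite !(exprD _ (2 * k) (2 * k)).
have e (x : R) : 0 <= x ^+ (2 * k) by rewrite exprM exprn_ge0// sqr_ge0.
have := e (X w); have := e (Y w).
move: (X w ^+ _) (Y w ^+ _) => a b a0 b0; rewrite ger0_norm ?mulr_ge0//.
by have := sqr_ge0 (a - b); have := mulr_ge0 a0 b0; rewrite expr2; lra.
Qed.

Lemma all_momentsZ (c : R) Y : all_moments Y -> all_moments (fun w => c * Y w).
Proof. by move=> ?; apply: all_momentsM => //; exact: all_moments_cst. Qed.

Lemma all_momentsN Y : all_moments Y -> all_moments (fun w => - Y w).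
Proof.
by move=> ?; under eq_fun do rewrite -mulN1r; exact: all_momentsZ.
Qed.

Lemma all_momentsB X Y : all_moments X -> all_moments Y ->
  all_moments (fun w => X w - Y w).
Proof. by move=> ? ?; apply: all_momentsD => //; exact: all_momentsN. Qed.

Lemma all_momentsX k Y : all_moments Y -> all_moments (fun w => Y w ^+ k).
Proof.
move=> mY; elim: k => [|k IH].
  exact: (all_moments_cst 1).
rewrite (_ : (fun w => _) = (fun w => Y w * Y w ^+ k)); first exact: all_momentsM.
by apply/funext => w; rewrite exprS.
Qed.

Lemma all_moments_sum (I : Type) (s : seq I) (Q : pred I) (F : I -> T -> R) :
  (forall i, Q i -> all_moments (F i)) ->
  all_moments (fun w => \sum_(i <- s | Q i) F i w).
Proof.
move=> mF; elim: s => [|i s IH].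
  by under eq_fun do rewrite big_nil; exact: all_moments_cst.
rewrite (_ : (fun w => _) = (fun w => (if Q i then F i w else 0) +
    \sum_(j <- s | Q j) F j w)); last first.
  by apply/funext => w; rewrite big_cons; case: ifP => // _; rewrite add0r.
apply: all_momentsD => //; case: (boolP (Q i)) => Qi; first exact: mF.
exact: all_moments_cst.
Qed.

Lemma all_moments_integrable Y : all_moments Y ->
  P.-integrable [set: T] (EFin \o Y).
Proof.
move=> [mY iY]; apply: (@integrable_dominated _ (fun w => 1 + Y w ^+ (2 * 1))) => //.
  under eq_fun do rewrite EFinD; apply: integrableD => //.
  exact: finite_measure_integrable_cst.
move=> w; rewrite muln1 -[Y w ^+ 2]real_normK ?num_real//.
have : 0 <= `|Y w| by []. nra.
Qed.

Lemma ExD X Y : all_moments X -> all_moments Y ->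
  Ex (fun w => X w + Y w) = Ex X + Ex Y.
Proof. by move=> ? ?; apply: RintegralD => //; exact: all_moments_integrable. Qed.

Lemma ExZ (c : R) X : all_moments X -> Ex (fun w => c * X w) = c * Ex X.
Proof. by move=> ?; apply: RintegralZl => //; exact: all_moments_integrable. Qed.

Lemma ExB X Y : all_moments X -> all_moments Y ->
  Ex (fun w => X w - Y w) = Ex X - Ex Y.
Proof. by move=> ? ?; apply: RintegralB => //; exact: all_moments_integrable. Qed.

Lemma Ex_cst (c : R) : Ex (fun=> c) = c.
Proof. by rewrite /Ex Rintegral_cst//= probability_setT mulr1. Qed.

Lemma Ex_le X Y : all_moments X -> all_moments Y ->
  (forall w, X w <= Y w) -> Ex X <= Ex Y.
Proof. by move=> ? ? ?; apply: le_Rintegral => //; exact: all_moments_integrable. Qed.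

Lemma Ex_ge0 X : (forall w, 0 <= X w) -> 0 <= Ex X.
Proof. by move=> ?; exact: Rintegral_ge0. Qed.

Lemma Ex_sum (I : Type) (s : seq I) (F : I -> T -> R) :
  (forall i, all_moments (F i)) ->
  Ex (fun w => \sum_(i <- s) F i w) = \sum_(i <- s) Ex (F i).
Proof.
move=> mF; elim: s => [|i s IH].
  by rewrite big_nil -[RHS]Ex_cst; apply: eq_Rintegral => w _; rewrite big_nil.
rewrite big_cons -IH -ExD//; last exact: all_moments_sum.
by apply: eq_Rintegral => w _; rewrite big_cons.
Qed.

Lemma EFin_Ex Y : all_moments Y -> (\int[P]_w (Y w)%:E = (Ex Y)%:E)%E.
Proof.
move=> /all_moments_integrable iY; rewrite /Ex /Rintegral fineK//.
exact: integrable_fin_num.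
Qed.

End AllMoments.

(** * Gaussian moments *)

Section NormalDensity.
Context {R : realType}.
Local Notation mu := (@lebesgue_measure R).

(** The change of variables produces an abstract Radon-Nikodym derivative, which agrees with the
    normal density only almost everywhere; that is enough under the integral. *)
Lemma ge0_integral_normal_prob (m s : R) (f : R -> \bar R) :
  measurable_fun [set: R] f -> (forall x, 0 <= f x)%E ->
  (\int[normal_prob m s]_x f x = \int[mu]_x (f x * (normal_pdf m s x)%:E))%E.
Proof.
move=> mf f0.
rewrite -(Radon_Nikodym_SigmaFinite.change_of_variables (normal_prob_dominates m s))//.
have nm := normal_prob_dominates m s.
have mg := measurable_int _ (Radon_Nikodym_SigmaFinite.f_integrable nm).
have mp : measurable_fun [set: R] (fun x => (normal_pdf m s x)%:E).
  by apply/measurable_EFinP; exact: measurable_normal_pdf.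
apply: ge0_ae_eq_integral => //.
- exact: emeasurable_funM.
- exact: emeasurable_funM.
- by move=> x _; rewrite mule_ge0//; exact: Radon_Nikodym_SigmaFinite.f_ge0.
- by move=> x _; rewrite mule_ge0// lee_fin normal_pdf_ge0.
have : ae_eq mu [set: R] (Radon_Nikodym_SigmaFinite.f (normal_prob m s) mu)
    (fun x => (normal_pdf m s x)%:E).
  apply: integral_ae_eq => //.
    exact: (Radon_Nikodym_SigmaFinite.f_integrable nm).
  by move=> E _ mE; rewrite -Radon_Nikodym_SigmaFinite.f_integral.
by apply: filterS => x /= + _ => -> .
Qed.

End NormalDensity.

Section GaussianMoments.
Context {d} {T : measurableType d} {R : realType} (P : probability T R).
Variables (X : T -> R) (s : R).
Hypotheses (mX : measurable_fun [set: T] X) (s_gt0 : 0 < s).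
Hypothesis lawX : forall B : set R, measurable B -> P (X @^-1` B) = normal_prob 0 s B.
Local Notation mu := (@lebesgue_measure R).

Let s_neq0 : s != 0. Proof. by rewrite gt_eqF. Qed.

Lemma ge0_integral_gaussian (f : R -> R) :
  measurable_fun [set: R] f -> (forall x, 0 <= f x) ->
  (\int[P]_w (f (X w))%:E = \int[mu]_x (f x * normal_pdf 0 s x)%:E)%E.
Proof.
move=> mf f0; have mf' : measurable_fun [set: R] (EFin \o f) by exact/measurable_EFinP.
have mX' : @measurable_fun _ _ T (measurableTypeR R) [set: T] X by exact: mX.
pose X' : {RV P >-> measurableTypeR R} :=
  @mfun_Sub _ _ T (measurableTypeR R) X (mem_set mX').
transitivity (\int[distribution P X']_x (f x)%:E)%E.
  by rewrite ge0_integral_distribution// => x; rewrite lee_fin.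
transitivity (\int[normal_prob 0 s]_x (f x)%:E)%E.
  exact: (@eq_measure_integral _ (measurableTypeR R) R setT (normal_prob 0 s)
    (distribution P X') _ (fun A mA _ => lawX mA)).
by rewrite ge0_integral_normal_prob.
Qed.

(* The integrand is [t] times the ratio of the centred normal densities of scales
   [t * s] and [s]. *)
Lemma integral_expR_sqr_gaussian (t : R) : 0 < t ->
  (\int[P]_w (expR ((1 - t ^- 2) / (2 * s ^+ 2) * X w ^+ 2))%:E = t%:E)%E.
Proof.
move=> t0; rewrite (@ge0_integral_gaussian (fun x => expR ((1 - t ^- 2) / (2 * s ^+ 2) * x ^+ 2))).
- have ts : t * s != 0 by rewrite mulf_neq0// gt_eqF.
  transitivity (\int[mu]_x (t%:E * (normal_pdf 0 (t * s) x)%:E))%E.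
    apply: eq_integral => x _; rewrite -EFinM; congr EFin.
    rewrite !normal_pdfE//.
    have -> : normal_peak (t * s) = t^-1 * normal_peak s.
      rewrite /normal_peak -invfM; congr (_^-1).
      rewrite exprMn -mulrA -mulrnAr sqrtrM ?sqr_ge0// sqrtr_sqr ger0_norm//; exact: ltW.
    rewrite mulrCA -[in RHS]mulrA mulVKf ?gt_eqF//; congr (_ * _).
    rewrite /normal_fun -expRD; congr expR; rewrite !subr0.
    by field; rewrite s_neq0 gt_eqF.
  rewrite integralZl//; last exact: integrable_normal_pdf.
  by rewrite integral_normal_pdf mule1.
- by apply: measurableT_comp => //; apply: measurable_funM => //; exact: measurable_funX.
- by move=> x; exact: expR_ge0.
Qed.

(** The integrand is the ratio of the normal densities of means [m] and [0] with the same scale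
    [s]. *)
Lemma integral_expR_gaussian (m : R) :
  (\int[P]_w (expR (m / s ^+ 2 * X w - m ^+ 2 / (2 * s ^+ 2)))%:E = 1)%E.
Proof.
rewrite (@ge0_integral_gaussian (fun x => expR (m / s ^+ 2 * x - m ^+ 2 / (2 * s ^+ 2)))).
- rewrite -(integral_normal_pdf m s); apply: eq_integral => x _; congr EFin.
  rewrite !normal_pdfE// mulrCA; congr (_ * _).
  rewrite /normal_fun -expRD; congr expR; rewrite !subr0.
  by field; rewrite s_neq0.
- by apply: measurableT_comp => //; apply: measurable_funB => //; exact: measurable_funM.
- by move=> x; exact: expR_ge0.
Qed.

(** The case [t = 2] of [integral_expR_sqr_gaussian], hence of mean [2]. It dominates every even
    power of [X] up to a constant. *)
Let expq w := expR (3 / (8 * s ^+ 2) * X w ^+ 2).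

Let measurable_expq : measurable_fun [set: T] expq.
Proof.
by apply: measurableT_comp => //; apply: measurable_funM => //; exact: measurable_funX.
Qed.

Let integral_expq : (\int[P]_w (expq w)%:E = (2 : R)%:E)%E.
Proof.
have e : 3 / (8 * s ^+ 2) = (1 - 2 ^- 2) / (2 * s ^+ 2) by field.
by rewrite /expq e; apply: integral_expR_sqr_gaussian.
Qed.

Let integrable_expq : P.-integrable [set: T] (fun w => (expq w)%:E).
Proof.
apply/integrableP; split; first exact/measurable_EFinP.
under eq_integral do rewrite gee0_abs ?lee_fin ?expR_ge0//.
by rewrite integral_expq ltry.
Qed.

(** With [y] the exponent in [expq], this is [y / k.+1 <= expR (y / k.+1)] raised to the power
    [k.+1]. *)
Let X_expq k w : X w ^+ (2 * k.+1) <= (8 * k.+1%:R * s ^+ 2 / 3) ^+ k.+1 * expq w.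
Proof.
have y0 : 0 <= 3 / (8 * s ^+ 2) * X w ^+ 2.
  by rewrite mulr_ge0 ?sqr_ge0// divr_ge0// mulr_ge0// sqr_ge0.
rewrite /expq; set y := 3 / (8 * s ^+ 2) * X w ^+ 2.
have k0 : k.+1%:R != 0 :> R by rewrite pnatr_eq0.
have -> : X w ^+ (2 * k.+1) = (8 * k.+1%:R * s ^+ 2 / 3) ^+ k.+1 * (y / k.+1%:R) ^+ k.+1.
  rewrite -exprMn exprM; congr (_ ^+ _); rewrite /y; field; rewrite s_neq0; lra.
apply: ler_wpM2l.
  by rewrite exprn_ge0// divr_ge0// mulr_ge0 ?sqr_ge0.
rewrite [y in leRHS](_ : _ = k.+1%:R * (y / k.+1%:R)); last by field.
rewrite expRM_natl; apply: lerXn2r; rewrite ?nnegrE ?expR_ge0 ?divr_ge0//.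
by apply: le_trans (expR_ge1Dx _); rewrite lerDr.
Qed.

Lemma all_moments_gaussian : all_moments P X.
Proof.
split=> // -[|k].
  by under eq_fun do rewrite muln0; exact: finite_measure_integrable_cst.
apply: (@integrable_dominated _ _ _ _ _
  (fun w => (8 * k.+1%:R * s ^+ 2 / 3) ^+ k.+1 * expq w)).
- exact: measurable_funX.
- by under eq_fun do rewrite EFinM; exact: integrableZl.
by move=> w; rewrite ger0_norm//; rewrite exprM exprn_ge0// sqr_ge0.
Qed.

(** The fourth and eighth moments are needed only up to a constant uniform in bounded [s]; the exact
    values matter for the first two moments alone. *)
Lemma Ex_gaussian_even_le k :
  Ex P (fun w => X w ^+ (2 * k.+1)) <= 2 * (8 * k.+1%:R * s ^+ 2 / 3) ^+ k.+1.
Proof.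
rewrite -lee_fin -EFin_Ex; last by apply: all_momentsX; exact: all_moments_gaussian.
apply: (@le_trans _ _ (\int[P]_w ((8 * k.+1%:R * s ^+ 2 / 3) ^+ k.+1 * expq w)%:E)%E).
  apply: ge0_le_integral => //=.
  - by move=> w _; rewrite lee_fin exprM exprn_ge0// sqr_ge0.
  - by apply/measurable_EFinP; exact: measurable_funX.
  - by apply/measurable_EFinP; exact: measurable_funM.
  by move=> w _; rewrite lee_fin.
under eq_integral do rewrite EFinM.
by rewrite integralZl// integral_expq -EFinM mulrC.
Qed.

(** Recovers moments without computing an integral: [1 + x <= expR x] is integrated against an
    exponential of known mean, and a one-parameter family of such exponentials leaves a single
    possible value for the moment. *)
Let Ex_quadratic_le (a b c : R) (g : T -> R) (l : R) :
  measurable_fun [set: T] g -> (\int[P]_w (expR (g w))%:E = l%:E)%E ->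
  (forall w, g w = a * X w ^+ 2 + b * X w + c) ->
  1 + (a * Ex P (fun w => X w ^+ 2) + b * Ex P X + c) <= l.
Proof.
move=> mg gl gE; have aX := all_moments_gaussian.
have aX2 := all_momentsX 2 aX.
have ag : all_moments P (fun w => 1 + (a * X w ^+ 2 + b * X w + c)).
  do ?[apply: all_momentsD|apply: all_momentsZ|exact: all_moments_cst] => //.
have -> : 1 + (a * Ex P (fun w => X w ^+ 2) + b * Ex P X + c) =
    Ex P (fun w => 1 + (a * X w ^+ 2 + b * X w + c)).
  rewrite !ExD ?ExZ ?Ex_cst//;
  do ?[apply: all_momentsD|apply: all_momentsZ|exact: all_moments_cst] => //.
have ig : P.-integrable [set: T] (fun w => (expR (g w))%:E).
  apply/integrableP; split; first by apply/measurable_EFinP; exact: measurableT_comp.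
  by under eq_integral do rewrite gee0_abs ?lee_fin ?expR_ge0//; rewrite gl ltry.
rewrite -lee_fin -gl -EFin_Ex//; apply: le_integral => //.
  exact: all_moments_integrable.
by move=> w _; rewrite lee_fin -gE expR_ge1Dx.
Qed.

(* [1 + x <= expR x] in [integral_expR_gaussian] gives [m * E X <= m ^ 2 / 2] for all [m]. *)
Lemma Ex_gaussian : Ex P X = 0.
Proof.
have h (m : R) : m * Ex P X <= m ^+ 2 / 2.
  have h : 1 + (0 * Ex P (fun w => X w ^+ 2) + m / s ^+ 2 * Ex P X +
      - (m ^+ 2 / (2 * s ^+ 2))) <= 1.
    apply: Ex_quadratic_le (integral_expR_gaussian m) _; last by move=> w; ring.
    by apply: measurable_funB => //; exact: measurable_funM.
  have s2 : 0 < s ^+ 2 by rewrite exprn_gt0.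
  have : (m * Ex P X - m ^+ 2 / 2) / s ^+ 2 <= 0.
    have -> : (m * Ex P X - m ^+ 2 / 2) / s ^+ 2 =
      m / s ^+ 2 * Ex P X - m ^+ 2 / (2 * s ^+ 2) by field.
    lra.
  by rewrite pmulr_lle0 ?invr_gt0// subr_le0.
(* At [m = E X] the inequality reads [(E X)^2 <= (E X)^2 / 2]. *)
have := h (Ex P X); rewrite -expr2 => h1.
apply/eqP; rewrite -sqrf_eq0 eq_le sqr_ge0 andbT.
by move: h1; lra.
Qed.

(* [1 + x <= expR x] in [integral_expR_sqr_gaussian] gives
   [1 + (1 - t ^- 2) / 2 * (E X ^ 2 / s ^ 2) <= t] for all [t > 0]. *)
Lemma Ex_gaussian_sqr : Ex P (fun w => X w ^+ 2) = s ^+ 2.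
Proof.
set v := Ex P _; have s2 : 0 < s ^+ 2 by rewrite exprn_gt0.
pose m := v / s ^+ 2.
suff : m = 1 by rewrite /m => /divr1_eq.
have h (t : R) : 0 < t -> (t ^+ 2 - 1) * m <= 2 * (t - 1) * t ^+ 2.
  move=> t0.
  have h1 : 1 + ((1 - t ^- 2) / (2 * s ^+ 2) * v + 0 * Ex P X + 0) <= t.
    apply: Ex_quadratic_le (integral_expR_sqr_gaussian t0) _; last by move=> w; ring.
    by apply: measurable_funM => //; exact: measurable_funX.
  have t2 : 0 < t ^+ 2 by rewrite exprn_gt0.
  have : (1 - t ^- 2) / 2 * m <= t - 1.
    have -> : (1 - t ^- 2) / 2 * m = (1 - t ^- 2) / (2 * s ^+ 2) * v.
      by rewrite /m; field; rewrite s_neq0 gt_eqF.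
    lra.
  rewrite -(ler_pM2l (mulr_gt0 (ltr0n R 2) t2)).
  have -> : 2 * t ^+ 2 * ((1 - t ^- 2) / 2 * m) = (t ^+ 2 - 1) * m.
    by field; rewrite gt_eqF.
  by rewrite mulrAC.
(* Dividing [h] by [t - 1] gives [(t + 1) * m <= 2 * t^2] for [t = 1 + e] and the reverse for
   [t = 1 - e]. Both force [m = 1] as [e] tends to [0]; the polynomials here and in [lo] are
   convenient weakenings. *)
have hi (e : R) : 0 < e -> m <= 1 + 3 * e + 2 * e ^+ 2.
  move=> e0; have := h (1 + e) (addr_gt0 ltr01 e0).
  have -> : (1 + e) ^+ 2 - 1 = e * (2 + e) by ring.
  have -> : 2 * (1 + e - 1) * (1 + e) ^+ 2 = e * (2 * (1 + e) ^+ 2) by ring.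
  rewrite -mulrA ler_pM2l// => h1; rewrite leNgt; apply/negP => h2.
  have : (2 + e) * (1 + 3 * e + 2 * e ^+ 2) < (2 + e) * m by rewrite ltr_pM2l//; lra.
  have : 0 < e ^+ 2 by rewrite exprn_gt0.
  have : 0 < e ^+ 3 by rewrite exprn_gt0.
  have -> : (2 + e) * (1 + 3 * e + 2 * e ^+ 2) = 2 + 7 * e + 7 * e ^+ 2 + 2 * e ^+ 3 by ring.
  have : 2 * (1 + e) ^+ 2 = 2 + 4 * e + 2 * e ^+ 2 by ring.
  move: h1.
  lra.
have lo (e : R) : 0 < e -> e < 1 -> 1 - 2 * e <= m.
  move=> e0 e1; have := h (1 - e); rewrite subr_gt0 => /(_ e1).
  have -> : ((1 - e) ^+ 2 - 1) * m = - (e * ((2 - e) * m)) by ring.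
  have -> : 2 * (1 - e - 1) * (1 - e) ^+ 2 = - (e * (2 * (1 - e) ^+ 2)) by ring.
  rewrite lerN2 ler_pM2l// => h1; rewrite leNgt; apply/negP => h2.
  have : (2 - e) * m < (2 - e) * (1 - 2 * e) by rewrite ltr_pM2l//; lra.
  have : 0 < e ^+ 2 by rewrite exprn_gt0.
  have -> : (2 - e) * (1 - 2 * e) = 2 - 5 * e + 2 * e ^+ 2 by ring.
  have : 2 * (1 - e) ^+ 2 = 2 - 4 * e + 2 * e ^+ 2 by ring.
  move: h1.
  lra.
apply/eqP; rewrite eq_le; apply/andP; split; apply/ler_addgt0Pr => e e0.
  have [e1|e1] := leP e 1.
    apply: (le_trans (hi (e / 5) _)); first by rewrite divr_gt0.
    have : e ^+ 2 <= e by rewrite expr2 ler_piMr// ltW.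
    have -> : 2 * (e / 5) ^+ 2 = 2 / 25 * e ^+ 2 by field.
    lra.
  apply: (le_trans (hi (1 / 5) _)); first lra.
  lra.
have [e1|e1] := leP e 1; last by have := lo (1/2); lra.
have := lo (e / 2); lra.
Qed.

End GaussianMoments.

(** * Independence of one coordinate from all the others *)

Section ProductRule.
Context {d} {T : measurableType d} {R : realType} (P : probability T R).
Variables U V : T -> R.
Hypothesis indepUV : forall A B : set R, measurable A -> measurable B ->
  (P (U @^-1` A `&` V @^-1` B) = P (U @^-1` A) * P (V @^-1` B))%E.

(** The joint law agrees with the product of the marginal laws on rectangles, hence everywhere, and
    Fubini's theorem separates the two integrals. *)
Lemma Ex_prod : all_moments P U -> all_moments P V ->
  Ex P (fun w => U w * V w) = Ex P U * Ex P V.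
Proof.
move=> aU aV; have [mU _] := aU; have [mV _] := aV.
have aUV := all_momentsM aU aV.
pose U' : {RV P >-> R} := mfun_Sub (mem_set mU).
pose V' : {RV P >-> R} := mfun_Sub (mem_set mV).
have mW : measurable_fun [set: T] (fun w => (U w, V w)) by exact: measurable_fun_pair.
pose W' : {RV P >-> (R * R)%type} := mfun_Sub (mem_set mW).
have WUV A : measurable A ->
    (distribution P U' \x distribution P V')%E A = distribution P W' A.
  apply: product_measure_unique => A1 A2 mA1 mA2 /=.
  by rewrite /distribution/= /pushforward -indepUV//; congr (P _); apply/seteqP; split.
pose f (z : R * R) := (z.1 * z.2)%:E.
have mf : measurable_fun [set: R * R] f.
  by apply/measurable_EFinP; apply: measurable_funM.
have iU := all_moments_integrable aU; have iV := all_moments_integrable aV.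
have eqW : (\int[P]_w (U w * V w)%:E =
    \int[distribution P U' \x distribution P V']_z f z)%E.
  rewrite (@eq_measure_integral _ _ _ setT (distribution P W')); last first.
    by move=> A mA _; exact: WUV.
  rewrite integral_distribution//; exact: (all_moments_integrable aUV).
have mE : measurable_fun [set: R] (EFin : R -> \bar R) by exact/measurable_EFinP.
have dU : (\int[distribution P U']_x x%:E = (Ex P U)%:E)%E.
  by rewrite (@integral_distribution _ _ _ _ _ P U' _ mE iU)//= -EFin_Ex.
have dV : (\int[distribution P V']_x x%:E = (Ex P V)%:E)%E.
  by rewrite (@integral_distribution _ _ _ _ _ P V' _ mE iV)//= -EFin_Ex.
have iU' : (distribution P U').-integrable [set: R] EFin.
  by apply/integrable_pushforward.
have iV' : (distribution P V').-integrable [set: R] EFin.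
  by apply/integrable_pushforward.
have h1 (x : R) : (\int[distribution P V']_y `|f (x, y)| =
    `|x%:E| * \int[distribution P V']_y `|y%:E|)%E.
  rewrite -ge0_integralZl//; last exact: measurableT_comp.
  by apply: eq_integral => y _; rewrite /f EFinM abseM.
have h2 (x : R) : (\int[distribution P V']_y f (x, y) = x%:E * (Ex P V)%:E)%E.
  by rewrite -dV -integralZl//; apply: eq_integral => y _; rewrite /f EFinM.
apply: EFin_inj; rewrite EFinM -EFin_Ex// eqW -integral12_prod_meas1; last first.
  apply/integrable12ltyP => //.
  rewrite (eq_integral _ _ (fun x _ => h1 x)) ge0_integralZr//.
  - case/integrableP: iU' => _ hU; case/integrableP: iV' => _ hV.
    by rewrite lte_mul_pinfty// ?integral_ge0// ge0_fin_numE// integral_ge0.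
  - exact: measurableT_comp.
  - exact: integral_ge0.
by rewrite /fubini_F (eq_integral _ _ (fun x _ => h2 x)) integralZr// dU.
Qed.

End ProductRule.

Section LeaveOneOut.
Context {d} {T : measurableType d} {R : realType} (P : probability T R).
Context {I : finType} (X : I -> T -> R).
Hypothesis indepX : mutually_independent P X.

(** A pi-system generating the sigma-algebra of all coordinates but [p], in the form on which the
    product rule is known. *)
Definition others_cylinders (p : I) : set (set T) :=
  [set A | exists2 B : I -> set R, (forall i, measurable (B i)) &
     A = \bigcap_(i in [set j | j \in ~: [set p]]) X i @^-1` B i].

(** Says that [Y] depends only on the other coordinates without exhibiting the dependence, so
    resolvents qualify by closure properties alone. *)
Definition others_measurable (p : I) (Y : T -> R) :=
  @measurable_fun _ _ (g_sigma_algebraType (others_cylinders p)) R setT Y.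

Let mX i : measurable_fun [set: T] (X i). Proof. exact: indepX.1. Qed.

Lemma others_sigma_measurable p (A : set T) :
  <<s others_cylinders p >> A -> measurable A.
Proof.
apply: smallest_sub; first exact: sigma_algebra_measurable.
move=> _ [B mB ->]; apply: fin_bigcap_measurable => // i _.
by rewrite -[_ @^-1` _]setTI; exact: mX.
Qed.

Lemma others_measurableW p Y : others_measurable p Y -> measurable_fun [set: T] Y.
Proof.
by move=> mY _ B mB; apply: (@others_sigma_measurable p); exact: mY.
Qed.

Lemma others_measurable_coord p q : q != p -> others_measurable p (X q).
Proof.
move=> qp _ B mB; apply: sub_sigma_algebra.
exists (fun i => if i == q then B else setT) => [i|].
  by case: ifP.
rewrite setTI; apply/seteqP; split=> [w Bw i _|w /(_ q)].
  by case: eqP => // ->.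
by rewrite eqxx; apply; rewrite /= !inE.
Qed.

(** Dynkin's argument: the events [A] obeying the product rule are stable under complements and
    disjoint unions, and include the rectangles. *)
Lemma others_indep p (B A : set _) : measurable B -> <<s others_cylinders p >> A ->
  (P (X p @^-1` B `&` A) = P (X p @^-1` B) * P A)%E.
Proof.
move=> mB; have mXB : measurable (X p @^-1` B).
  by rewrite -[_ @^-1` _]setTI; exact: mX.
have hC (S : set T) : measurable S ->
    (P (X p @^-1` B `&` S) = P (X p @^-1` B) * P S)%E ->
    (P (X p @^-1` B `&` ~` S) = P (X p @^-1` B) * P (~` S))%E.
  move=> mS PS.
  have fin A' : measurable A' -> (P A' < +oo)%E.
    by move=> mA'; rewrite -ge0_fin_numE// fin_num_measure.
  transitivity (P (X p @^-1` B) - P (X p @^-1` B `&` S))%E.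
    by rewrite -setDE; apply: measureD => //; exact: fin.
  by rewrite PS probability_setC// muleBr ?mule1// ?fin_num_measure.
have hU (F : (set T)^nat) : (forall n, measurable (F n)) -> trivIset setT F ->
    (forall n, P (X p @^-1` B `&` F n) = P (X p @^-1` B) * P (F n))%E ->
    (P (X p @^-1` B `&` \bigcup_k F k) = P (X p @^-1` B) * P (\bigcup_k F k))%E.
  move=> mF tF PF; rewrite setI_bigcupr measure_bigcup//; last 2 first.
    by move=> n _; exact: measurableI.
    exact: trivIset_setIl.
  have Pa : P (X p @^-1` B) = (fine (P (X p @^-1` B)))%:E.
    by rewrite fineK// fin_num_measure.
  rewrite measure_bigcup// Pa -nneseriesZl//.
  by apply: eq_eseriesr => n _; rewrite -Pa; exact: PF.
move: A; apply: (@dynkin_induction _ (g_sigma_algebraType (others_cylinders p))).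
- by [].
- move=> _ _ [B1 mB1 ->] [B2 mB2 ->]; exists (fun i => B1 i `&` B2 i).
    by move=> i; exact: measurableI.
  by rewrite -bigcapI; apply: eq_bigcapr => i _; rewrite preimage_setI.
- by rewrite setIT probability_setT mule1.
- move=> _ [C mC ->].
  (* Inserting [B] as the factor at [p] turns the intersection into a rectangle in all coordinates,
     so the product rule over the whole of [I] applies. *)
  pose C' i := if i == p then B else C i.
  have mC' i : measurable (C' i) by rewrite /C'; case: ifP.
  rewrite (indepX.2 (~: [set p])%SET C mC).
  have -> : (P (X p @^-1` B) * \prod_(i in (~: [set p])%SET) P (X i @^-1` C i) =
      \prod_(i in [set: I]%SET) P (X i @^-1` C' i))%E.
    rewrite [RHS](bigD1 p) ?inE//=; congr (_ * _)%E; first by rewrite /C' eqxx.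
    apply: eq_big => [i|i]; rewrite !inE// => ip; by rewrite /C' (negbTE ip).
  rewrite -(indepX.2 [set: I]%SET C' mC').
  + congr (P _); apply/seteqP; split => [w [Bw Cw] i _|w Cw].
      rewrite /C'; have [->//|ip] := eqVneq i p.
      by apply: Cw; rewrite /= !inE.
    split=> [|i]; first by have := Cw p; rewrite /C' eqxx; apply; rewrite /= inE.
    by rewrite /= !inE => ip; have := Cw i; rewrite /C' (negbTE ip); apply; rewrite /= inE.
- by move=> S mS; apply: hC; exact: others_sigma_measurable mS.
- by move=> F mF; apply: hU => n; exact: others_sigma_measurable (mF n).
Qed.

(** Stands in for conditioning on all coordinates but [p]: powers of [X p] are averaged out, and
    random coefficients pass through unchanged. *)
Lemma Ex_others p Y (f : R -> R) : others_measurable p Y -> measurable_fun [set: R] f ->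
  all_moments P Y -> all_moments P (fun w => f (X p w)) ->
  Ex P (fun w => Y w * f (X p w)) = Ex P Y * Ex P (fun w => f (X p w)).
Proof.
move=> oY mf aY af; apply: Ex_prod => // A B mA mB.
rewrite setIC muleC; apply: (@others_indep p (f @^-1` B) (Y @^-1` A)).
  by rewrite -[f @^-1` B]setTI; exact: mf.
by rewrite -[Y @^-1` A]setTI; exact: oY.
Qed.

End LeaveOneOut.

(** * Fourth moment of a centred quadratic form *)

Section QuadraticForm.
Context {d} {T : measurableType d} {R : realType} (P : probability T R).
Context {I : finType} (X : I -> T -> R).
Hypothesis indepX : mutually_independent P X.

Definition others_moments (r : I) (Y : T -> R) :=
  others_measurable X r Y /\ all_moments P Y.

Lemma others_moments_cst r (c : R) : others_moments r (fun=> c).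
Proof. by split; [exact: measurable_cst|exact: all_moments_cst]. Qed.

Lemma others_momentsD r Y Z : others_moments r Y -> others_moments r Z ->
  others_moments r (fun w => Y w + Z w).
Proof.
move=> [oY aY] [oZ aZ]; split; last exact: all_momentsD.
exact: (measurable_funD oY oZ).
Qed.

Lemma others_momentsM r Y Z : others_moments r Y -> others_moments r Z ->
  others_moments r (fun w => Y w * Z w).
Proof.
move=> [oY aY] [oZ aZ]; split; last exact: all_momentsM.
exact: (measurable_funM oY oZ).
Qed.

Lemma others_momentsX r k Y : others_moments r Y ->
  others_moments r (fun w => Y w ^+ k).
Proof.
move=> [oY aY]; split; last exact: all_momentsX.
exact: (measurable_funX k oY).
Qed.

Lemma others_momentsB r Y Z : others_moments r Y -> others_moments r Z ->
  others_moments r (fun w => Y w - Z w).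
Proof.
move=> [oY aY] [oZ aZ]; split; last exact: all_momentsB.
exact: (measurable_funB oY oZ).
Qed.

Lemma others_moments_sum r (J : eqType) (s : seq J) (F : J -> T -> R) :
  (forall i, i \in s -> others_moments r (F i)) ->
  others_moments r (fun w => \sum_(i <- s) F i w).
Proof.
elim: s => [|i s IH] oF.
  by under eq_fun do rewrite big_nil; exact: others_moments_cst.
rewrite (_ : (fun w => _) = (fun w => F i w + \sum_(j <- s) F j w)); last first.
  by apply/funext => w; rewrite big_cons.
apply: others_momentsD; first by apply: oF; rewrite mem_head.
by apply: IH => j js; apply: oF; rewrite inE js orbT.
Qed.

Local Ltac all_moments_tac := repeat first [assumption | exact: all_moments_cst
  | apply: all_momentsX | apply: all_momentsD | apply: all_momentsM | apply: all_momentsN].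
Local Ltac others_moments_tac := repeat first [assumption | exact: others_moments_cst
  | apply: others_momentsX | apply: others_momentsD | apply: others_momentsM].

(** [blk] holds the coordinates of the vector in which the form is quadratic; all remaining
    randomness enters through [G], which no block coordinate influences. *)
Variables (blk : pred I) (G : I -> I -> T -> R) (v m4 m8 C : R).
Hypotheses (m4_ge0 : 0 <= m4) (C_ge0 : 0 <= C).
Hypothesis aX : forall p, blk p -> all_moments P (X p).
Hypothesis EX1 : forall p, blk p -> Ex P (X p) = 0.
Hypothesis EX2 : forall p, blk p -> Ex P (fun w => X p w ^+ 2) = v.
Hypothesis EX4 : forall p, blk p -> Ex P (fun w => X p w ^+ 4) <= m4.
Hypothesis EX8 : forall p, blk p -> Ex P (fun w => X p w ^+ 8) <= m8.
Hypothesis oG : forall p q r, blk p -> blk q -> blk r -> others_moments r (G p q).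
Hypothesis symG : forall p q w, blk p -> blk q -> G p q w = G q p w.
(* Only the row norms of the (random) matrix [G] enter the bound. *)
Hypothesis rowG : forall p (s : seq I) w, blk p -> all blk s -> uniq s ->
  \sum_(q <- s) G p q w ^+ 2 <= C.

Lemma others_moments_coord p r : blk p -> p != r -> others_moments r (X p).
Proof. by move=> bp pr; split; [exact: others_measurable_coord|exact: aX]. Qed.

Let Ex_pow r k Y : blk r -> others_moments r Y ->
  Ex P (fun w => Y w * X r w ^+ k) = Ex P Y * Ex P (fun w => X r w ^+ k).
Proof.
move=> br [oY aY]; apply: (Ex_others indepX (f := fun x => x ^+ k)) => //.
by apply: all_momentsX; exact: aX.
Qed.

Let Ex_lin r Y : blk r -> others_moments r Y -> Ex P (fun w => Y w * X r w) = 0.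
Proof.
move=> br oY; have := Ex_pow 1 br oY.
by under eq_fun do rewrite expr1; move=> ->; rewrite EX1// mulr0.
Qed.

Definition row_form (p : I) (s : seq I) w := \sum_(q <- s) G p q w * X q w.

Lemma others_row_form p s r : blk p -> blk r -> all blk s -> r \notin s ->
  others_moments r (row_form p s).
Proof.
move=> bp br /allP bs rs; apply: others_moments_sum => q qs.
apply: others_momentsM; first by apply: oG => //; exact: bs.
by apply: others_moments_coord; [exact: bs|apply: contraNneq rs => <-].
Qed.

Let am Y r : others_moments r Y -> all_moments P Y. Proof. by case. Qed.

Let row_cons p q s w : row_form p (q :: s) w = G p q w * X q w + row_form p s w.
Proof. by rewrite /row_form big_cons. Qed.

Lemma all_moments_row_form p s : blk p -> all blk s -> all_moments P (row_form p s).
Proof.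
move=> bp; elim: s => [_|q s IH /= /andP[bq bs]].
  by rewrite /row_form; under eq_fun do rewrite big_nil; exact: all_moments_cst.
rewrite (_ : row_form _ _ = (fun w => G p q w * X q w + row_form p s w)); last first.
  by apply/funext => w; exact: row_cons.
apply: all_momentsD; last exact: IH.
by apply: all_momentsM; [case: (oG bp bq bq)|exact: aX].
Qed.

(** Adding a coordinate [q] creates a cross term linear in [X q], of mean zero. The weight [Y] is
    there for the fourth moment, which uses [G p q ^ 2]. *)
Lemma Ex_row_form_sqr p s Y : blk p -> all blk s -> uniq s ->
  (forall r, blk r -> others_moments r Y) ->
  Ex P (fun w => row_form p s w ^+ 2 * Y w) =
  v * Ex P (fun w => (\sum_(q <- s) G p q w ^+ 2) * Y w).
Proof.
move=> bp + + oY; elim: s => [_ _|q s IH /= /andP[bq bs] /andP[qs us]].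
  rewrite [X in _ = _ * X](_ : _ = 0); last first.
    by rewrite -[RHS](Ex_cst P 0); congr Ex; apply/funext => w; rewrite big_nil mul0r.
  rewrite mulr0 -[RHS](Ex_cst P 0); congr Ex; apply/funext => w.
  by rewrite /row_form big_nil expr2 !mul0r.
have oq := oY _ bq; have oGq := oG bp bq bq; have oV := others_row_form bp bq bs qs.
have aY := am oq; have aG := am oGq; have aV := am oV; have aXq := aX bq.
have aS : all_moments P (fun w => \sum_(q <- s) G p q w ^+ 2).
  apply: (@am _ q); apply: others_moments_sum => r rs; apply: others_momentsX.
  by apply: oG => //; exact: (allP bs).
have -> : (fun w => row_form p (q :: s) w ^+ 2 * Y w) = (fun w =>
    ((G p q w ^+ 2 * Y w) * X q w ^+ 2 + row_form p s w ^+ 2 * Y w) +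
    (2 * (G p q w * row_form p s w * Y w)) * X q w).
  by apply/funext => w; rewrite row_cons; ring.
rewrite ExD; last 2 first.
- by all_moments_tac.
- by all_moments_tac.
rewrite ExD; last 2 first.
- by all_moments_tac.
- by all_moments_tac.
rewrite Ex_lin//; last by others_moments_tac.
rewrite Ex_pow//; last by others_moments_tac.
rewrite IH// EX2// addr0 mulrC -mulrDr; congr (_ * _).
rewrite -ExD; last 2 first.
- by all_moments_tac.
- by apply: all_momentsM.
by congr Ex; apply/funext => w; rewrite big_cons mulrDl.
Qed.

Let C4 := (8 * v ^+ 2 + 3 * m4) * C.

Lemma Ex_row_form_pow4 p s : blk p -> all blk s -> uniq s ->
  Ex P (fun w => row_form p s w ^+ 4) <= C4 * C.
Proof.
move=> bp bs us.
(* The induction carries the sum of squared coefficients itself. Bounding each new one by [C] would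
   cost a factor [size s]; the row bound is applied once, at the end. *)
suff h : Ex P (fun w => row_form p s w ^+ 4) <=
    C4 * Ex P (fun w => \sum_(q <- s) G p q w ^+ 2).
  apply: le_trans h _; apply: ler_wpM2l.
    by rewrite mulr_ge0// addr_ge0// mulr_ge0// sqr_ge0.
  rewrite -[leRHS](Ex_cst P); apply: Ex_le; [|exact: all_moments_cst|].
    apply: (@am _ p); apply: others_moments_sum => r rs; apply: others_momentsX.
    by apply: oG => //; exact: (allP bs).
  by move=> w; exact: rowG.
elim: s bs us => [_ _|q s IH /= /andP[bq bs] /andP[qs us]].
  rewrite [X in _ <= _ * X](_ : _ = 0); last first.
    by rewrite -[RHS](Ex_cst P 0); congr Ex; apply/funext => w; rewrite big_nil.
  rewrite mulr0 [leLHS](_ : _ = 0)// -[RHS](Ex_cst P 0); congr Ex; apply/funext => w.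
  by rewrite /row_form big_nil expr0n.
have oGq := oG bp bq bq; have oV := others_row_form bp bq bs qs.
have aG := am oGq; have aV := am oV; have aXq := aX bq.
have oS r : blk r -> others_moments r (fun w => \sum_(q <- s) G p q w ^+ 2).
  move=> br; apply: others_moments_sum => r' rs; apply: others_momentsX.
  by apply: oG => //; exact: (allP bs).
have aS := am (oS q bq).
have EG2 : 0 <= Ex P (fun w => G p q w ^+ 2) by apply: Ex_ge0 => w; exact: sqr_ge0.
(* In the expansion of [(V + y)^4] with [y = g * x], the term [4 V y^3] is at most
   [2 V^2 y^2 + 2 y^4], whence the coefficients [8] and [3]. The term [4 V^3 y] is linear in [X q]
   and is kept because its mean vanishes. *)
apply: (@le_trans _ _ (Ex P (fun w =>
    (row_form p s w ^+ 4 + (8 * (row_form p s w ^+ 2 * G p q w ^+ 2)) * X q w ^+ 2) +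
    ((3 * G p q w ^+ 4) * X q w ^+ 4 +
    (4 * (row_form p s w ^+ 3 * G p q w)) * X q w)))).
  apply: Ex_le.
  - by apply: all_momentsX; apply: all_moments_row_form => //=; rewrite bq.
  - by all_moments_tac.
  - move=> w; rewrite row_cons.
    move: (row_form p s w) (G p q w) (X q w) => V g x.
    have : 0 <= (V * g * x - g ^+ 2 * x ^+ 2) ^+ 2 by exact: sqr_ge0.
    lra.
rewrite ExD; last 2 first.
- by all_moments_tac.
- by all_moments_tac.
rewrite ExD; last 2 first.
- by all_moments_tac.
- by all_moments_tac.
rewrite [X in _ + X]ExD; last 2 first.
- by all_moments_tac.
- by all_moments_tac.
rewrite Ex_lin//; last first.
  by others_moments_tac.
rewrite (Ex_pow 2)//; last first.
  by others_moments_tac.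
rewrite (Ex_pow 4)//; last first.
  by others_moments_tac.
rewrite ExZ; last by all_moments_tac.
rewrite ExZ; last by all_moments_tac.
rewrite (@Ex_row_form_sqr p s (fun w => G p q w ^+ 2))//; last first.
  by move=> r br; apply: others_momentsX; exact: oG.
rewrite EX2// addr0.
have h4 : Ex P (fun w => G p q w ^+ 4) <= C * Ex P (fun w => G p q w ^+ 2).
  rewrite -ExZ; last exact: all_momentsX.
  apply: Ex_le; [exact: all_momentsX|by apply: all_momentsZ; exact: all_momentsX|].
  move=> w; rewrite (_ : 4%N = (2 + 2)%N)// exprD ler_wpM2r ?sqr_ge0//.
  by have := @rowG p [:: q] w bp; rewrite big_seq1/= bq; apply.
have h2 : Ex P (fun w => (\sum_(q <- s) G p q w ^+ 2) * G p q w ^+ 2) <=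
    C * Ex P (fun w => G p q w ^+ 2).
  rewrite -ExZ; last exact: all_momentsX.
  apply: Ex_le; [by apply: all_momentsM => //; exact: all_momentsX|
    by apply: all_momentsZ; exact: all_momentsX|].
  by move=> w; rewrite ler_wpM2r ?sqr_ge0//; exact: rowG.
rewrite (_ : Ex P (fun w => \sum_(j <- q :: s) _) =
    Ex P (fun w => G p q w ^+ 2) + Ex P (fun w => \sum_(j <- s) G p j w ^+ 2)); last first.
  rewrite -ExD//; last exact: all_momentsX.
  by congr Ex; apply/funext => w; rewrite big_cons.
have {}IH := IH bs us.
rewrite mulrDr [leRHS]addrC -addrA lerD// /C4.
have l4 : 3 * Ex P (fun w => G p q w ^+ 4) * Ex P (fun w => X q w ^+ 4) <=
    3 * (C * Ex P (fun w => G p q w ^+ 2)) * m4.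
  apply: ler_pM; [|by apply: Ex_ge0 => w; rewrite (exprM _ 2 2) sqr_ge0| |exact: EX4].
    by rewrite mulr_ge0//; apply: Ex_ge0 => w; rewrite (exprM _ 2 2) sqr_ge0.
  by rewrite ler_wpM2l.
have l2 := ler_wpM2l (sqr_ge0 v) h2.
lra.
Qed.

Definition centered_form (s : seq I) w :=
  (\sum_(p <- s) \sum_(q <- s) G p q w * X p w * X q w) - v * \sum_(p <- s) G p p w.

Definition form_increment p s w :=
  G p p w * (X p w ^+ 2 - v) + 2 * (row_form p s w * X p w).

Let form_cons p s w : blk p -> all blk s ->
  centered_form (p :: s) w = centered_form s w + form_increment p s w.
Proof.
move=> bp bs; rewrite /centered_form /form_increment /row_form !big_cons.
rewrite [X in _ + X - _](eq_bigr (fun j => G j p w * X j w * X p w +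
    \sum_(q <- s) G j q w * X j w * X q w)); last by move=> j _; rewrite big_cons.
rewrite big_split/= mulr_suml.
have -> : \sum_(q <- s) G p q w * X p w * X q w = \sum_(q <- s) G p q w * X q w * X p w.
  by apply: eq_bigr => q _; ring.
have -> : \sum_(q <- s) G q p w * X q w * X p w = \sum_(q <- s) G p q w * X q w * X p w.
  by rewrite !big_seq; apply: eq_bigr => q qs; rewrite (symG _ bp)//; exact: (allP bs).
ring.
Qed.

Lemma others_centered_form r s : blk r -> all blk s -> r \notin s ->
  others_moments r (centered_form s).
Proof.
move=> br bs rs; have oXs q : q \in s -> others_moments r (X q).
  move=> qs; apply: others_moments_coord; first exact: (allP bs).
  by apply: contraNneq rs => <-.
have oGs q q' : q \in s -> q' \in s -> others_moments r (G q q').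
  by move=> qs q's; apply: oG => //; exact: (allP bs).
apply: others_momentsB.
  apply: others_moments_sum => p ps; apply: others_moments_sum => q qs.
  by apply: others_momentsM; [apply: others_momentsM; [exact: oGs|exact: oXs]|exact: oXs].
apply: others_momentsM; first exact: others_moments_cst.
by apply: others_moments_sum => p ps; exact: oGs.
Qed.

Let B := 64 * (C ^+ 2 * (m8 + v ^+ 4)) + 128 * (C4 * C * m4).

Lemma all_moments_form_increment p s : blk p -> all blk s ->
  all_moments P (form_increment p s).
Proof.
move=> bp bs; have aG := am (oG bp bp bp); have aXp := aX bp.
have aV := all_moments_row_form bp bs.
by all_moments_tac.
Qed.

(** Two uses of [(a + b)^4 <= 8 * (a^4 + b^4)], on the increment and on [X^2 - v], give [64 = 8 * 8]
    and [128 = 8 * 2^4]. Thanks to the row bound, [B] does not depend on [s]. *)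
Lemma Ex_form_increment_pow4 p s : blk p -> all blk s -> uniq s -> p \notin s ->
  Ex P (fun w => form_increment p s w ^+ 4) <= B.
Proof.
move=> bp bs us ps.
have aG := am (oG bp bp bp); have aXp := aX bp.
have oV := others_row_form bp bp bs ps; have aV := am oV.
apply: (@le_trans _ _ (Ex P (fun w => 64 * C ^+ 2 * (X p w ^+ 8 + v ^+ 4) +
    128 * (row_form p s w ^+ 4 * X p w ^+ 4)))).
  apply: Ex_le.
  - by apply: all_momentsX; exact: all_moments_form_increment.
  - by all_moments_tac.
  move=> w; rewrite /form_increment.
  have gC : G p p w ^+ 2 <= C.
    by have := @rowG p [:: p] w bp; rewrite big_seq1/= bp; apply.
  move: (row_form p s w) (G p p w) (X p w) gC => V g x gC.
  have p4 (a b : R) : (a + b) ^+ 4 <= 8 * (a ^+ 4 + b ^+ 4).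
    have : 0 <= 4 * (a ^+ 2 - b ^+ 2) ^+ 2 +
        (a - b) ^+ 2 * (2 * (a ^+ 2 + b ^+ 2) + (a + b) ^+ 2).
      by do ?[by []|exact: sqr_ge0|apply: addr_ge0|apply: mulr_ge0].
    lra.
  apply: le_trans (p4 _ _) _.
  have g4 : g ^+ 4 <= C ^+ 2.
    by rewrite (exprM g 2 2) lerXn2r// nnegrE ?sqr_ge0.
  have x8 : (x ^+ 2 - v) ^+ 4 <= 8 * (x ^+ 8 + v ^+ 4).
    apply: le_trans (p4 _ _) _; rewrite -exprM (_ : (- v) ^+ 4 = v ^+ 4)//.
    by rewrite -mulN1r exprMn; ring.
  have : g ^+ 4 * (x ^+ 2 - v) ^+ 4 <= C ^+ 2 * (8 * (x ^+ 8 + v ^+ 4)).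
    by apply: ler_pM => //; rewrite (exprM _ 2 2) sqr_ge0.
  rewrite !exprMn.
  lra.
rewrite ExD; last 2 first.
- by all_moments_tac.
- by all_moments_tac.
rewrite ExZ; last first.
  by all_moments_tac.
rewrite ExZ; last first.
  by all_moments_tac.
rewrite ExD; [|exact: all_momentsX|exact: all_moments_cst].
rewrite Ex_cst (Ex_pow 4)//; last exact: others_momentsX.
rewrite /B; apply: lerD.
  by rewrite -mulrA !ler_wpM2l ?sqr_ge0// lerD2r EX8.
rewrite ler_wpM2l//; apply: ler_pM.
- by apply: Ex_ge0 => w; rewrite (exprM _ 2 2) sqr_ge0.
- by apply: Ex_ge0 => w; rewrite (exprM _ 2 2) sqr_ge0.
- exact: Ex_row_form_pow4.
- exact: EX4.
Qed.

(** The martingale property in the form used: as [p] is not in [s], the increment is a combination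
    of [X p ^ 2 - v] and [X p], both centred, with coefficients that do not involve [X p]. *)
Lemma Ex_cube_form_increment p s : blk p -> all blk s -> uniq s -> p \notin s ->
  Ex P (fun w => centered_form s w ^+ 3 * form_increment p s w) = 0.
Proof.
move=> bp bs us ps.
have oGp := oG bp bp bp; have aXp := aX bp; have oD := others_centered_form bp bs ps.
have oV := others_row_form bp bp bs ps.
have aV := am oV; have aG := am oGp; have aD := am oD.
rewrite (_ : (fun w => _) = (fun w => ((centered_form s w ^+ 3 * G p p w) * X p w ^+ 2 +
   (- v) * (centered_form s w ^+ 3 * G p p w)) +
   (2 * (centered_form s w ^+ 3 * row_form p s w)) * X p w)); last first.
  by apply/funext => w; rewrite /form_increment; ring.
rewrite ExD; last 2 first.
- by all_moments_tac.
- by all_moments_tac.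
rewrite ExD; last 2 first.
- by all_moments_tac.
- by all_moments_tac.
rewrite Ex_lin//; last first.
  by others_moments_tac.
rewrite Ex_pow//; last first.
  by others_moments_tac.
rewrite ExZ; last first.
  by all_moments_tac.
rewrite EX2//; ring.
Qed.

Lemma all_moments_centered_form s : all blk s -> all_moments P (centered_form s).
Proof.
move=> /allP bs; apply: all_momentsB; last first.
  apply: all_momentsZ; rewrite (_ : (fun w => _) = (fun w => \sum_(p <- s | blk p) G p p w)).
    by apply: all_moments_sum => p bp; case: (oG bp bp bp).
  by apply/funext => w; rewrite [RHS]big_mkcond big_seq [RHS]big_seq; apply: eq_bigr => p /bs ->.
rewrite (_ : (fun w => _) =
    (fun w => \sum_(p <- s | blk p) \sum_(q <- s | blk q) G p q w * X p w * X q w)).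
  apply: all_moments_sum => p bp; apply: all_moments_sum => q bq.
  by do 2 ?[apply: all_momentsM]; [case: (oG bp bq bp)|exact: aX|exact: aX].
apply/funext => w; rewrite [RHS]big_mkcond big_seq [RHS]big_seq.
apply: eq_bigr => p /bs ->; rewrite [RHS]big_mkcond big_seq [RHS]big_seq.
by apply: eq_bigr => q /bs ->.
Qed.

(* Adding one coordinate at a time makes [centered_form] a martingale with increments
   [form_increment]; the cubic cross term vanishes by [Ex_cube_form_increment] and
   [6 a^2 z^2 + 4 a z^3 + z^4 <= a^4 / k + 19 k z^4] with [k = size s + 1]. *)
Lemma Ex_centered_form_pow4 s : all blk s -> uniq s ->
  Ex P (fun w => centered_form s w ^+ 4) <= 19 * B * (size s)%:R ^+ 2.
Proof.
elim: s => [_ _|p s IH /= /andP[bp bs] /andP[ps us]].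
  rewrite /= expr0n mulr0 [leLHS](_ : _ = 0)// -[RHS](Ex_cst P 0).
  by congr Ex; apply/funext => w; rewrite /centered_form !big_nil mulr0 subr0 expr0n.
have {IH} := IH bs us.
have h4 := Ex_form_increment_pow4 bp bs us ps.
have h3 := Ex_cube_form_increment bp bs us ps.
have aD := all_moments_centered_form bs.
have aZ := all_moments_form_increment bp bs.
set S := (fun w => centered_form s w); set Z := form_increment p s.
set k : R := (size s)%:R; rewrite -[(size s).+1%:R]natr1 -/k => IH.
have k0 : 0 <= k by rewrite ler0n.
have k1 : 0 < k + 1 by lra.
have -> : (fun w => centered_form (p :: s) w ^+ 4) = (fun w => (S w + Z w) ^+ 4).
  by apply/funext => w; rewrite form_cons.
apply: (@le_trans _ _ (Ex P (fun w => ((1 + (k + 1)^-1) * S w ^+ 4 +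
    19 * (k + 1) * Z w ^+ 4) + 4 * (S w ^+ 3 * Z w)))).
  apply: Ex_le.
  - by apply: all_momentsX; exact: all_momentsD.
  - by all_moments_tac.
  move=> w; move: (S w) (Z w) => a z.
  (* [e3] replaces [4 a z^3] by [2 a^2 z^2 + 2 z^4], and [e1] splits the resulting [8 a^2 z^2] with
     weight [k + 1]: the constant is [19 = 16 + 3]. *)
  have e1 : 0 <= (k + 1)^-1 * (a ^+ 2 - 4 * (k + 1) * z ^+ 2) ^+ 2.
    by rewrite mulr_ge0 ?sqr_ge0// invr_ge0 ltW.
  have e1' : (k + 1)^-1 * (a ^+ 2 - 4 * (k + 1) * z ^+ 2) ^+ 2 =
      (k + 1)^-1 * a ^+ 4 - 8 * (a ^+ 2 * z ^+ 2) + 16 * ((k + 1) * z ^+ 4).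
    by field; rewrite gt_eqF.
  have e2 : 0 <= k * z ^+ 4 by rewrite mulr_ge0// (exprM _ 2 2) sqr_ge0.
  have e3 : 0 <= (a * z - z ^+ 2) ^+ 2 by exact: sqr_ge0.
  rewrite e1' in e1.
  move: e1 e2 e3; move: ((k + 1)^-1) => j.
  lra.
rewrite ExD; last 2 first.
- by all_moments_tac.
- by all_moments_tac.
rewrite ExD; last 2 first.
- by all_moments_tac.
- by all_moments_tac.
rewrite !ExZ; try by all_moments_tac.
rewrite h3 mulr0 addr0.
have B0 : 0 <= B.
  by apply: le_trans h4; apply: Ex_ge0 => w; rewrite (exprM _ 2 2) sqr_ge0.
have l1 : (1 + (k + 1)^-1) * Ex P (fun w => S w ^+ 4) <= (1 + (k + 1)^-1) * (19 * B * k ^+ 2).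
  by apply: ler_wpM2l => //; rewrite addr_ge0// invr_ge0 ltW.
have l2 : 19 * (k + 1) * Ex P (fun w => Z w ^+ 4) <= 19 * (k + 1) * B.
  by apply: ler_wpM2l => //; rewrite mulr_ge0// ltW.
apply: le_trans (lerD l1 l2) _.
have -> : (1 + (k + 1)^-1) * (19 * B * k ^+ 2) + 19 * (k + 1) * B =
    19 * B * (k ^+ 2 + k ^+ 2 / (k + 1) + (k + 1)) by field; rewrite gt_eqF.
apply: ler_wpM2l; first by rewrite mulr_ge0.
(* The induction closes because [k^2 + k + (k + 1) = (k + 1)^2]. *)
have : k ^+ 2 / (k + 1) <= k.
  by rewrite ler_pdivrMr// expr2 ler_wpM2l// lerDl.
move: (k ^+ 2 / _) => j; lra.
Qed.

End QuadraticForm.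
Local Open Scope complex_scope.

(** * Resolvents of Gram matrices *)

Section ConjugateTranspose.
Context {R : realType}.
Implicit Types m n p : nat.

Lemma ctrE m n (A : 'M[R[i]]_(m, n)) i j : ctr A i j = (A j i)^*.
Proof. by rewrite !mxE. Qed.

Lemma ctrK m n (A : 'M[R[i]]_(m, n)) : ctr (ctr A) = A.
Proof. by apply/matrixP => i j; rewrite !ctrE conjcK. Qed.

Lemma ctrM m n p (A : 'M[R[i]]_(m, n)) (B : 'M[R[i]]_(n, p)) :
  ctr (A *m B) = ctr B *m ctr A.
Proof. by rewrite /ctr (map_mxM (@conjc R)) trmx_mul. Qed.

Lemma ctrD m n (A B : 'M[R[i]]_(m, n)) : ctr (A + B) = ctr A + ctr B.
Proof. by apply/matrixP => i j; rewrite !mxE rmorphD. Qed.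

Lemma ctr0 m n : ctr (0 : 'M[R[i]]_(m, n)) = 0.
Proof. by apply/matrixP => i j; rewrite !mxE rmorph0. Qed.

Lemma ctr_sum m n (I : Type) (r : seq I) (Q : pred I) (F : I -> 'M[R[i]]_(m, n)) :
  ctr (\sum_(i <- r | Q i) F i) = \sum_(i <- r | Q i) ctr (F i).
Proof. by apply: (big_morph _ (@ctrD m n)); exact: ctr0. Qed.

Lemma ctr_scalar n (x : R) : ctr ((x%:C)%:M : 'M[R[i]]_n) = (x%:C)%:M.
Proof.
by apply/matrixP => i j; rewrite !mxE eq_sym; case: eqP => _; rewrite ?conjc_real// rmorph0.
Qed.

Definition sqnorm n (u : 'cV[R[i]]_n) : R :=
  \sum_i (complex.Re (u i ord0) ^+ 2 + complex.Im (u i ord0) ^+ 2).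

Lemma ctr_mul_self n (u : 'cV[R[i]]_n) : (ctr u *m u) ord0 ord0 = (sqnorm u)%:C.
Proof.
rewrite mxE /sqnorm rmorph_sum; apply: eq_bigr => i _.
by rewrite ctrE mulrC -sqr_normc -add_Re2_Im2.
Qed.

Lemma sqnorm_ge0 n (u : 'cV[R[i]]_n) : 0 <= sqnorm u.
Proof. by apply: sumr_ge0 => i _; rewrite addr_ge0 ?sqr_ge0. Qed.

Lemma sqnorm_eq0 n (u : 'cV[R[i]]_n) : sqnorm u = 0 -> u = 0.
Proof.
move=> /eqP; rewrite psumr_eq0; last by move=> i _; rewrite addr_ge0 ?sqr_ge0.
move=> /allP h; apply/matrixP => i j; rewrite ord1 mxE.
have := h i (mem_index_enum i); rewrite paddr_eq0 ?sqr_ge0// !sqrf_eq0.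
by case: (u i ord0) => a b /= /andP[/eqP -> /eqP ->].
Qed.

Lemma sqnorm_entry n (u : 'cV[R[i]]_n) i :
  complex.Re (u i ord0) ^+ 2 <= sqnorm u.
Proof.
rewrite /sqnorm (bigD1 i)//= -addrA lerDl addr_ge0 ?sqr_ge0//.
by apply: sumr_ge0 => j _; rewrite addr_ge0 ?sqr_ge0.
Qed.

End ConjugateTranspose.

Section Resolvent.
Context {R : realType} (N m : nat) (beta : R) (bs : 'I_m -> 'cV[R[i]]_N).
Hypothesis beta_gt0 : 0 < beta.
Implicit Types Q : pred 'I_m.

(** Users are selected by a predicate so that removing one changes neither the family [bs] nor the
    type of the matrix. *)
Definition gram Q : 'M[R[i]]_N :=
  \sum_(k < m | Q k) bs k *m ctr (bs k) + (beta%:C)%:M.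

Definition resolvent Q := invmx (gram Q).

Lemma ctr_gram Q : ctr (gram Q) = gram Q.
Proof.
rewrite /gram ctrD ctr_scalar ctr_sum; congr (_ + _).
by apply: eq_bigr => k _; rewrite ctrM ctrK.
Qed.

(** Each rank one term contributes the squared modulus of [ctr (bs k) *m u]. The order is the one of
    the complex numbers, so the inequality also says that the form is real. *)
Lemma gram_form_ge Q u :
  (beta * sqnorm u)%:C <= (ctr u *m gram Q *m u) ord0 ord0.
Proof.
rewrite /gram mulmxDr mulmxDl mul_mx_scalar -scalemxAl.
rewrite [X in _ <= X]mxE [X in _ <= _ + X]mxE ctr_mul_self -rmorphM lerDr.
rewrite mulmx_sumr mulmx_suml summxE; apply: sumr_ge0 => k _.
rewrite mulmxA -mulmxA.
have -> : ctr u *m bs k = ctr (ctr (bs k) *m u) by rewrite ctrM ctrK.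
by rewrite ctr_mul_self ler0c sqnorm_ge0.
Qed.

Lemma gram_inj Q (u : 'cV_N) : gram Q *m u = 0 -> u = 0.
Proof.
move=> h; have := gram_form_ge Q u; rewrite -mulmxA h mulmx0 mxE.
rewrite (_ : 0 = (0 : R)%:C)// lecR pmulr_rle0// => s0.
by apply: sqnorm_eq0; apply/eqP; rewrite eq_le s0 sqnorm_ge0.
Qed.

Lemma gram_unit Q : gram Q \in unitmx.
Proof.
rewrite -row_free_unit; apply: inj_row_free => v vA.
have : gram Q *m ctr v = 0 by rewrite -ctr_gram -ctrM vA ctr0.
by move=> /gram_inj h; rewrite -[v]ctrK h ctr0.
Qed.

Lemma gramK Q : gram Q *m resolvent Q = 1%:M.
Proof. exact: mulmxV (gram_unit Q). Qed.

Lemma resolventK Q : resolvent Q *m gram Q = 1%:M.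
Proof. exact: mulVmx (gram_unit Q). Qed.

Lemma ctr_resolvent Q : ctr (resolvent Q) = resolvent Q.
Proof.
have h : ctr (resolvent Q) *m gram Q = 1%:M.
  rewrite -[X in _ *m X]ctr_gram -ctrM gramK; exact: (ctr_scalar N 1).
by rewrite -[LHS]mulmx1 -(gramK Q) mulmxA h mul1mx.
Qed.

Definition rform Q (b : 'cV[R[i]]_N) : R :=
  complex.Re ((ctr b *m resolvent Q *m b) ord0 ord0).

(** With [u = A^-1 b], the form equals [u^H A u], to which [gram_form_ge] applies. *)
Lemma resolvent_form Q b : (ctr b *m resolvent Q *m b) ord0 ord0 = (rform Q b)%:C /\
  0 <= rform Q b.
Proof.
have h : 0 <= (ctr b *m resolvent Q *m b) ord0 ord0.
  have -> : ctr b *m resolvent Q *m b =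
      ctr (resolvent Q *m b) *m gram Q *m (resolvent Q *m b).
    by rewrite ctrM ctr_resolvent -!mulmxA (mulmxA (gram Q)) gramK mul1mx.
  apply: le_trans (gram_form_ge Q _).
  by rewrite ler0c mulr_ge0 ?sqnorm_ge0// ltW.
split; last by move: h; rewrite lecE => /andP[].
by rewrite /rform RRe_real// ger0_real.
Qed.

Lemma rform_ge0 Q b : 0 <= rform Q b.
Proof. by case: (resolvent_form Q b). Qed.

(** For [u] the [i]-th column of the resolvent, [u^H A u] is the conjugate of [u_i]. Hence
    [beta * |u|^2 <= Re u_i <= |u|], so [|u| <= 1 / beta], without any spectral theory; Hermitian
    symmetry passes from columns to rows. *)
Lemma resolvent_row Q i :
  \sum_j (complex.Re (resolvent Q i j) ^+ 2 + complex.Im (resolvent Q i j) ^+ 2)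
    <= beta ^- 2.
Proof.
pose u := resolvent Q *m delta_mx i ord0 : 'cV_N.
have uE j : u j ord0 = resolvent Q j i by rewrite /u -colE mxE.
have -> : \sum_j (complex.Re (resolvent Q i j) ^+ 2 + complex.Im (resolvent Q i j) ^+ 2)
    = sqnorm u.
  apply: eq_bigr => j _; rewrite uE -{1 2}(ctr_resolvent Q) ctrE.
  by case: (resolvent Q j i) => x y /=; rewrite sqrrN.
have := gram_form_ge Q u.
have -> : (ctr u *m gram Q *m u) ord0 ord0 = (u i ord0)^*.
  have gu : gram Q *m u = delta_mx i ord0 by rewrite /u mulmxA gramK mul1mx.
  by rewrite -mulmxA gu -colE mxE ctrE.
rewrite lecE => /andP[_ /=].
rewrite (_ : complex.Re (u i ord0)^* = complex.Re (u i ord0)); last first.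
  by case: (u i ord0).
move=> h; have := sqnorm_entry u i; have := sqnorm_ge0 u.
move: (sqnorm u) (complex.Re (u i ord0)) h => n x h n0 xn.
have h2 : (beta * n) ^+ 2 <= n.
  apply: le_trans xn; apply: lerXn2r; rewrite ?nnegrE ?mulr_ge0// ?(ltW beta_gt0)//.
  by apply: le_trans h; rewrite mulr_ge0// ltW.
have [->|nz] := eqVneq n 0; first by rewrite invr_ge0 sqr_ge0.
have npos : 0 < n by rewrite lt_def nz.
rewrite -[leRHS]mul1r ler_pdivlMr ?exprn_gt0//.
by rewrite -(ler_pM2l npos) mulr1; move: h2; rewrite exprMn; lra.
Qed.

Lemma resolvent_trace Q : beta * complex.Re (\tr (resolvent Q)) +
  \sum_(k < m | Q k) rform Q (bs k) = N%:R.
Proof.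
have : \tr (gram Q *m resolvent Q) = N%:R by rewrite gramK mxtrace1.
rewrite /gram mulmxDl mulmx_suml raddfD/= raddf_sum/= mul_scalar_mx mxtraceZ.
rewrite (eq_bigr (fun k => (rform Q (bs k))%:C)); last first.
  move=> k _; have [<- _] := resolvent_form Q (bs k).
  by rewrite -mulmxA mxtrace_mulC /mxtrace big_ord_recl big_ord0 addr0.
rewrite -rmorph_sum addrC => /(congr1 (@complex.Re R)).
case: (\tr _) => x y /=; rewrite mul0r subr0 => ->.
by rewrite -(rmorph_nat (real_complex R)).
Qed.

(* Sherman-Morrison: removing the rank one term of user [k] from the Gram matrix. *)
Lemma rform_leave_one_out Q k : Q k ->
  rform Q (bs k) = 1 - (1 + rform [pred l | Q l && (l != k)] (bs k))^-1.
Proof.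
move=> Qk; set Q' := [pred l | _]; set b := bs k.
have gE : gram Q = gram Q' + b *m ctr b.
  by rewrite /gram (bigD1 k)//= -/b -addrA [LHS]addrC.
have [g'E g'0] := resolvent_form Q' b; set g' := rform Q' b in g'E g'0 *.
have n0 : 1 + g' != 0 by rewrite gt_eqF// ltr_pwDl.
have e1 : gram Q *m (resolvent Q' *m b) = (1 + g')%:C *: b.
  rewrite gE mulmxDl mulmxA gramK mul1mx -mulmxA (mulmxA (ctr b)).
  rewrite [ctr b *m _ *m b]mx11_scalar g'E mul_mx_scalar.
  by rewrite rmorphD rmorph1 scalerDl scale1r.
have e2 : resolvent Q *m b = ((1 + g')^-1)%:C *: (resolvent Q' *m b).
  have := congr1 (mulmx (resolvent Q)) e1.
  rewrite mulmxA resolventK mul1mx -scalemxAr => ->.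
  by rewrite scalerA -rmorphM mulVf// scale1r.
rewrite /rform -mulmxA e2 -scalemxAr mulmxA mxE g'E -rmorphM /=.
by field.
Qed.

End Resolvent.

(** * Measurability of resolvents *)

(** The point [0], where inversion is not continuous, is split off as a measurable singleton. *)
Lemma measurable_invr {R : realType} : measurable_fun [set: R] (@GRing.inv R).
Proof.
rewrite -(setUv [set (0 : R)]); apply/measurable_funU => //; first exact: measurableC.
split; first exact: measurable_fun_set1.
apply: open_continuous_measurable_fun.
  by rewrite openC; exact: closed_eq.
by move=> x; rewrite inE /= => /eqP x0; exact: inv_continuous.
Qed.

Section ComplexMeasurable.
Context {d} {T : measurableType d} {R : realType}.
Implicit Types f g : T -> R[i].

(** The measurable space [T] is left arbitrary: these closure lemmas are used both for the full
    sigma-algebra and for the one generated by all coordinates but one. *)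
Definition cmeasurable f :=
  measurable_fun [set: T] (fun w => complex.Re (f w)) /\
  measurable_fun [set: T] (fun w => complex.Im (f w)).

Lemma cmeasurable_cst (z : R[i]) : cmeasurable (fun=> z).
Proof. by split; exact: measurable_cst. Qed.

Lemma cmeasurableD f g : cmeasurable f -> cmeasurable g ->
  cmeasurable (fun w => f w + g w).
Proof.
move=> [rf mf] [rg mg]; split.
  rewrite (_ : (fun w => _) = (fun w => complex.Re (f w) + complex.Re (g w))).
    exact: measurable_funD.
  by apply/funext => w; case: (f w) (g w) => [? ?] [? ?].
rewrite (_ : (fun w => _) = (fun w => complex.Im (f w) + complex.Im (g w))).
  exact: measurable_funD.
by apply/funext => w; case: (f w) (g w) => [? ?] [? ?].
Qed.

Lemma cmeasurableM f g : cmeasurable f -> cmeasurable g ->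
  cmeasurable (fun w => f w * g w).
Proof.
move=> [rf mf] [rg mg]; split.
  rewrite (_ : (fun w => _) = (fun w => complex.Re (f w) * complex.Re (g w) -
      complex.Im (f w) * complex.Im (g w))).
    by apply: measurable_funB; exact: measurable_funM.
  by apply/funext => w; case: (f w) (g w) => [? ?] [? ?].
rewrite (_ : (fun w => _) = (fun w => complex.Re (f w) * complex.Im (g w) +
    complex.Im (f w) * complex.Re (g w))).
  by apply: measurable_funD; exact: measurable_funM.
by apply/funext => w; case: (f w) (g w) => [? ?] [? ?].
Qed.

Lemma cmeasurable_conj f : cmeasurable f -> cmeasurable (fun w => (f w)^*).
Proof.
move=> [rf mf]; split.
  rewrite (_ : (fun w => _) = (fun w => complex.Re (f w)))//.
  by apply/funext => w; case: (f w).
rewrite (_ : (fun w => _) = (fun w => - complex.Im (f w))).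
  exact: measurableT_comp.
by apply/funext => w; case: (f w).
Qed.

Lemma cmeasurableV f : cmeasurable f -> cmeasurable (fun w => (f w)^-1).
Proof.
move=> [rf mf].
have mi : measurable_fun [set: T]
    (fun w => (complex.Re (f w) ^+ 2 + complex.Im (f w) ^+ 2)^-1).
  apply: (measurableT_comp measurable_invr).
  by apply: measurable_funD; exact: measurable_funX.
split.
  rewrite (_ : (fun w => _) = (fun w => complex.Re (f w) *
      (complex.Re (f w) ^+ 2 + complex.Im (f w) ^+ 2)^-1)).
    exact: measurable_funM.
  by apply/funext => w; case: (f w).
rewrite (_ : (fun w => _) = (fun w => - (complex.Im (f w) *
    (complex.Re (f w) ^+ 2 + complex.Im (f w) ^+ 2)^-1))).
  by apply: measurableT_comp => //; exact: measurable_funM.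
by apply/funext => w; case: (f w).
Qed.

Lemma cmeasurable_sum (I : Type) (s : seq I) (Q : pred I) (F : I -> T -> R[i]) :
  (forall i, Q i -> cmeasurable (F i)) -> cmeasurable (fun w => \sum_(i <- s | Q i) F i w).
Proof.
move=> mF; elim: s => [|i s IH].
  by under eq_fun do rewrite big_nil; exact: cmeasurable_cst.
have [Qi|/negbTE Qi] := boolP (Q i); last first.
  rewrite (_ : (fun w => _) = (fun w => \sum_(j <- s | Q j) F j w))//.
  by apply/funext => w; rewrite big_cons Qi.
rewrite (_ : (fun w => _) = (fun w => F i w + \sum_(j <- s | Q j) F j w)).
  by apply: cmeasurableD => //; exact: mF.
by apply/funext => w; rewrite big_cons Qi.
Qed.

Lemma cmeasurable_prod (I : Type) (s : seq I) (F : I -> T -> R[i]) :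
  (forall i, cmeasurable (F i)) -> cmeasurable (fun w => \prod_(i <- s) F i w).
Proof.
move=> mF; elim: s => [|i s IH].
  by under eq_fun do rewrite big_nil; exact: cmeasurable_cst.
rewrite (_ : (fun w => _) = (fun w => F i w * \prod_(j <- s) F j w)).
  by apply: cmeasurableM.
by apply/funext => w; rewrite big_cons.
Qed.

Lemma cmeasurable_det n (A : T -> 'M[R[i]]_n) :
  (forall i j, cmeasurable (fun w => A w i j)) -> cmeasurable (fun w => \det (A w)).
Proof.
move=> mA; apply: cmeasurable_sum => s _; apply: cmeasurableM.
  exact: cmeasurable_cst.
by apply: cmeasurable_prod => i.
Qed.

(** By the cofactor formula the entries of the inverse are rational functions of those of [A];
    invertibility at every [w] selects that branch of [invmx]. *)
Lemma cmeasurable_invmx n (A : T -> 'M[R[i]]_n) :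
  (forall w, A w \in unitmx) -> (forall i j, cmeasurable (fun w => A w i j)) ->
  forall i j, cmeasurable (fun w => invmx (A w) i j).
Proof.
move=> uA mA i j.
rewrite (_ : (fun w => _) = (fun w => (\det (A w))^-1 *
    ((-1) ^+ (j + i) * \det (row' j (col' i (A w)))))); last first.
  by apply/funext => w; rewrite /invmx uA !mxE.
apply: cmeasurableM; first by apply: cmeasurableV; exact: cmeasurable_det.
apply: cmeasurableM; first exact: cmeasurable_cst.
apply: cmeasurable_det => k l.
by under eq_fun do rewrite !mxE; exact: mA.
Qed.

Lemma cmeasurable_gram N m (beta : R) (Q : pred 'I_m) (bs : 'I_m -> T -> 'cV[R[i]]_N) :
  (forall k j, Q k -> cmeasurable (fun w => bs k w j ord0)) ->
  forall i j, cmeasurable (fun w => gram beta (fun k => bs k w) Q i j).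
Proof.
move=> mb i j; rewrite (_ : (fun w => _) = (fun w =>
    \sum_(k < m | Q k) bs k w i ord0 * (bs k w j ord0)^* + (beta%:C)%:M i j)).
  apply: cmeasurableD; last exact: cmeasurable_cst.
  apply: cmeasurable_sum => k Qk; apply: cmeasurableM; first exact: mb.
  by apply: cmeasurable_conj; exact: mb.
apply/funext => w; rewrite /gram mxE summxE; congr (_ + _).
by apply: eq_bigr => k _; rewrite mxE big_ord1 ctrE.
Qed.

Lemma cmeasurable_resolvent N m (beta : R) (Q : pred 'I_m)
    (bs : 'I_m -> T -> 'cV[R[i]]_N) : 0 < beta ->
  (forall k j, Q k -> cmeasurable (fun w => bs k w j ord0)) ->
  forall i j, cmeasurable (fun w => resolvent beta (fun k => bs k w) Q i j).
Proof.
move=> b0 mb; apply: cmeasurable_invmx; last exact: cmeasurable_gram.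
by move=> w; exact: gram_unit.
Qed.

End ComplexMeasurable.

(** * Deviation of a quadratic form in the resolvent from its conditional mean *)

(* [V], [C], [m4], [m8] bound the variance, the squared row norms of the resolvent and the
   fourth and eighth moments of a coordinate; see [Ex_centered_form_pow4] for [2 * N]
   real coordinates. *)
Definition deviation_bound {R : realType} (lo hi : R) : R :=
  let V := hi / 2 in let C := lo ^- 2 in
  let m4 := 2 * (16 * V / 3) ^+ 2 in let m8 := 2 * (32 * V / 3) ^+ 4 in
  76 * (64 * (C ^+ 2 * (m8 + V ^+ 4)) + 128 * ((8 * V ^+ 2 + 3 * m4) * C * C * m4)).

Section Deviation.
Context {d} {T : measurableType d} {R : realType} (P : probability T R).
Variables (N m : nat) (phi : R) (phis : 'I_m -> R) (beta lo hi : R).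
Variables (b : T -> 'cV[R[i]]_N) (bs : 'I_m -> T -> 'cV[R[i]]_N).
Hypothesis lo_gt0 : 0 < lo.
Hypothesis beta_bnd : lo <= beta <= hi.
Hypothesis model : CN_model P phi phis b bs.

Local Notation X := (cn_components b bs).
Local Notation J := ('I_N * bool)%type.
Local Notation I := (J + ('I_m * 'I_N * bool))%type.

Let beta_gt0 : 0 < beta. Proof. by case/andP: beta_bnd => h _; exact: lt_le_trans h. Qed.

(* [e] embeds the real coordinates of the vector [u] (either [b] or one of the [bs k])
   into those of the whole model; the users in [Q] have no coordinate in common with [u]. *)
Variables (Q : pred 'I_m) (e : J -> I) (einv : I -> option J).
Variables (u : T -> 'cV[R[i]]_N) (phiu : R).
Hypothesis eK : pcancel e einv.
Hypothesis Xe : forall j w, X (e (j, false)) w = complex.Re (u w j ord0) /\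
  X (e (j, true)) w = complex.Im (u w j ord0).
Hypothesis var_e : forall x, cn_variance phi phis (e x) = phiu / 2.
Hypothesis phiu_bnd : lo <= phiu <= hi.
Hypothesis Qe : forall k j c x, Q k -> inr (k, j, c) != e x.

Definition block : pred I := [pred i | i \in codom e].

(* The symmetric real matrix of the Hermitian form in real and imaginary parts. *)
Definition form_coef (w : T) (p q : J) : R :=
  let z := resolvent beta (fun k => bs k w) Q p.1 q.1 in
  match p.2, q.2 with
  | false, true => - complex.Im z
  | true, false => complex.Im z
  | _, _ => complex.Re z
  end.

(** The general quadratic form has coefficients indexed by all coordinates of the model, hence the
    default value [0] outside the block. *)
Definition form_coef_ext (p q : I) w : R :=
  match einv p, einv q with
  | Some p', Some q' => form_coef w p' q'
  | _, _ => 0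
  end.

Definition deviation w : R := rform beta (fun k => bs k w) Q (u w) -
  phiu * complex.Re (\tr (resolvent beta (fun k => bs k w) Q)).

Let coef_e x y w : form_coef_ext (e x) (e y) w = form_coef w x y.
Proof. by rewrite /form_coef_ext !eK. Qed.

Let cmeas_bs r k j : Q k -> r \in codom e ->
  @cmeasurable _ (g_sigma_algebraType (others_cylinders X r)) R
    (fun w => bs k w j ord0).
Proof.
move=> Qk /codomP[x ->]; split.
  exact: (others_measurable_coord (q := inr (k, j, false)) (Qe _ _ _ Qk)).
exact: (others_measurable_coord (q := inr (k, j, true)) (Qe _ _ _ Qk)).
Qed.

Let res_row w i := resolvent_row (fun k => bs k w) beta_gt0 Q i.

Let res_bound w i j : let z := resolvent beta (fun k => bs k w) Q i j in
  `|complex.Re z| <= beta^-1 /\ `|complex.Im z| <= beta^-1.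
Proof.
move=> z; have := res_row w i; rewrite (bigD1 j)//= -/z => h.
have {}h : complex.Re z ^+ 2 + complex.Im z ^+ 2 <= beta^-1 ^+ 2.
  rewrite -exprVn in h; apply: le_trans h; rewrite lerDl.
  by apply: sumr_ge0 => l _; rewrite addr_ge0 ?sqr_ge0.
have b0 : 0 <= beta^-1 by rewrite invr_ge0 ltW.
have r0 := sqr_ge0 (complex.Re z); have i0 := sqr_ge0 (complex.Im z).
split; rewrite -(ler_pXn2r (n := 2))// ?nnegrE// real_normK ?num_real//; lra.
Qed.

Let others_coef r x y : r \in codom e ->
  others_moments P X r (fun w => form_coef w x y).
Proof.
move=> re; have := @cmeasurable_resolvent _ (g_sigma_algebraType (others_cylinders X r))
  R N m beta Q bs beta_gt0 (fun k j Qk => cmeas_bs j Qk re) x.1 y.1.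
have bnd w := res_bound w x.1 y.1.
have mW := others_measurableW model.1 (p := r).
rewrite /form_coef => -[mr mi].
case: (x) (y) bnd mr mi => [i []] [j []] /= bnd mr mi.
- split=> //; apply: all_moments_bounded; first exact: mW mr.
  by move=> w; exact: (bnd w).1.
- split=> //; apply: all_moments_bounded; first exact: mW mi.
  by move=> w; exact: (bnd w).2.
- have mi' : others_measurable X r (fun w =>
    - complex.Im (resolvent beta (fun k => bs k w) Q i j)).
    exact: (measurableT_comp _ mi).
  split=> //; apply: all_moments_bounded; first exact: mW mi'.
  by move=> w; rewrite normrN; exact: (bnd w).2.
- split=> //; apply: all_moments_bounded; first exact: mW mr.
  by move=> w; exact: (bnd w).1.
Qed.

Let v := phiu / 2.
Let v_gt0 : 0 < v.
Proof. by rewrite divr_gt0//; case/andP: phiu_bnd => h _; exact: lt_le_trans h. Qed.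
Let V := hi / 2.
Let vV : v <= V.
Proof. by rewrite ler_pM2r//; case/andP: phiu_bnd. Qed.

Let gauss p : block p -> [/\ measurable_fun [set: T] (X p), 0 < Num.sqrt v &
  forall B : set R, measurable B -> P (X p @^-1` B) = normal_prob 0 (Num.sqrt v) B].
Proof.
move=> /codomP[x ->]; split; [exact: model.1.1|by rewrite sqrtr_gt0|].
by move=> B mB; rewrite /v -(var_e x); exact: model.2.
Qed.

Let sqrt_v : Num.sqrt v ^+ 2 = v. Proof. by rewrite sqr_sqrtr// ltW. Qed.

Let block_moments p : block p -> all_moments P (X p).
Proof. by move=> /gauss[mX s0 l]; exact: all_moments_gaussian l. Qed.

Let block_Ex1 p : block p -> Ex P (X p) = 0.
Proof. by move=> /gauss[mX s0 l]; exact: Ex_gaussian l. Qed.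

Let block_Ex2 p : block p -> Ex P (fun w => X p w ^+ 2) = v.
Proof. by move=> /gauss[mX s0 l]; rewrite (Ex_gaussian_sqr mX s0 l). Qed.

Let block_Ex4 p : block p -> Ex P (fun w => X p w ^+ 4) <= 2 * (16 * V / 3) ^+ 2.
Proof.
move=> /gauss[mX s0 l]; apply: le_trans (Ex_gaussian_even_le mX s0 l 1) _.
rewrite sqrt_v ler_wpM2l//; apply: lerXn2r; rewrite ?nnegrE.
- by move: v_gt0; lra.
- by move: v_gt0 vV; lra.
- by move: vV; lra.
Qed.

Let block_Ex8 p : block p -> Ex P (fun w => X p w ^+ 8) <= 2 * (32 * V / 3) ^+ 4.
Proof.
move=> /gauss[mX s0 l]; apply: le_trans (Ex_gaussian_even_le mX s0 l 3) _.
rewrite sqrt_v ler_wpM2l//; apply: lerXn2r; rewrite ?nnegrE.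
- by move: v_gt0; lra.
- by move: v_gt0 vV; lra.
- by move: vV; lra.
Qed.

Let block_others p q r : block p -> block q -> block r ->
  others_moments P X r (form_coef_ext p q).
Proof.
move=> /codomP[x ->] /codomP[y ->] br.
rewrite (_ : form_coef_ext _ _ = (fun w => form_coef w x y)); first exact: others_coef.
by apply/funext => w; rewrite coef_e.
Qed.

Let block_sym p q w : block p -> block q -> form_coef_ext p q w = form_coef_ext q p w.
Proof.
move=> /codomP[x ->] /codomP[y ->]; rewrite !coef_e /form_coef.
have -> : resolvent beta (fun k => bs k w) Q y.1 x.1 =
    (resolvent beta (fun k => bs k w) Q x.1 y.1)^*.
  by rewrite -[in LHS](ctr_resolvent (fun k => bs k w) beta_gt0 Q) ctrE.
case: x y => [i []] [j []] /=; case: (resolvent _ _ _ _ _) => //= ? ?.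
by rewrite opprK.
Qed.

Let sum_J (F : J -> R) : \sum_x F x = \sum_i (F (i, false) + F (i, true)).
Proof.
transitivity (\sum_i \sum_c F (i, c)); first by rewrite pair_bigA; apply: eq_bigr => -[].
by apply: eq_bigr => i _; rewrite big_bool/= addrC.
Qed.

Let block_uniq : uniq (codom e).
Proof. by rewrite map_inj_uniq ?enum_uniq//; exact: pcan_inj eK. Qed.

(** Completing [s] to the whole block only adds squares, and a full row of the real matrix collects
    the squared real and imaginary parts of one row of the resolvent. *)
Let block_row p (s : seq I) w : block p -> all block s -> uniq s ->
  \sum_(q <- s) form_coef_ext p q w ^+ 2 <= lo ^- 2.
Proof.
move=> /codomP[x ->] bs' us.
apply: (@le_trans _ _ (\sum_(q <- codom e) form_coef_ext (e x) q w ^+ 2)).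
  rewrite big_uniq//= [leRHS]big_uniq//= [leRHS]big_mkcond [leLHS]big_mkcond/=.
  apply: ler_sum => q _; have [qs|_] := boolP (q \in s); last by case: ifP; rewrite ?sqr_ge0.
  by have -> : q \in codom e by exact: (allP bs' q qs).
rewrite big_image/=; under eq_bigr do rewrite coef_e.
rewrite sum_J; apply: (@le_trans _ _ (beta ^- 2)); last first.
  case/andP: beta_bnd => lob _; rewrite lef_pV2 ?posrE ?exprn_gt0//.
  by apply: lerXn2r; rewrite ?nnegrE ?(ltW lo_gt0)// (le_trans (ltW lo_gt0)).
apply: le_trans (res_row w x.1); apply: ler_sum => j _.
by case: x => [i []]; rewrite /form_coef/= ?sqrrN// addrC.
Qed.

Let Re_sum (K : Type) (s : seq K) (F : K -> R[i]) :
  complex.Re (\sum_(i <- s) F i) = \sum_(i <- s) complex.Re (F i).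
Proof. by apply: (big_morph (@complex.Re R)) => // -[? ?] [? ?]. Qed.

Let deviationE w : deviation w = centered_form X form_coef_ext v (codom e) w.
Proof.
rewrite /deviation /centered_form; congr (_ - _); last first.
  (* Each diagonal entry occurs twice, for the real and the imaginary coordinate, which offsets
     [v = phiu / 2]. *)
  rewrite big_image/= sum_J Re_sum /v -mulrA; congr (_ * _).
  rewrite mulr_sumr; apply: eq_bigr => i _; by rewrite !coef_e /form_coef/=; field.
rewrite big_image/= sum_J /rform mxE Re_sum.
under eq_bigr do rewrite mxE mulr_suml Re_sum.
rewrite exchange_big/=; apply: eq_bigr => i _.
rewrite !big_image/= !sum_J -big_split/=; apply: eq_bigr => j _.
rewrite !coef_e /form_coef/= ctrE.
have [-> ->] := Xe i w; have [-> ->] := Xe j w.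
case: (u w i ord0) (u w j ord0) (resolvent _ _ _ i j) => [x1 y1] [x2 y2] [p q] /=.
ring.
Qed.

Lemma deviation_moments : all_moments P deviation /\
  Ex P (fun w => deviation w ^+ 4) <= deviation_bound lo hi * N%:R ^+ 2.
Proof.
have all_e : all block (codom e) by apply/allP.
have -> : deviation = centered_form X form_coef_ext v (codom e).
  by apply/funext => w; exact: deviationE.
split.
  by apply: all_moments_centered_form all_e; [exact: block_moments|exact: block_others].
have V0 : 0 <= V by rewrite (le_trans _ vV)// ltW.
have m4_0 : 0 <= 2 * (16 * V / 3) ^+ 2 by rewrite mulr_ge0// sqr_ge0.
have C0 : 0 <= lo ^- 2 by rewrite invr_ge0 sqr_ge0.
have := Ex_centered_form_pow4 model.1 m4_0 C0 block_moments
  block_Ex1 block_Ex2 block_Ex4 block_Ex8 block_others block_sym block_row all_e block_uniq.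
move=> h; apply: le_trans h _.
rewrite size_codom card_prod card_bool card_ord natrM /deviation_bound -/V.
have v4 : v ^+ 4 <= V ^+ 4 by apply: lerXn2r; rewrite ?nnegrE// ltW.
have v2 : v ^+ 2 <= V ^+ 2 by apply: lerXn2r; rewrite ?nnegrE// ltW.
set C := lo ^- 2 in C0 *; set m4 := 2 * _ in m4_0 *; set m8 := 2 * (32 * V / 3) ^+ 4.
have l1 : C ^+ 2 * v ^+ 4 <= C ^+ 2 * V ^+ 4 by rewrite ler_wpM2l ?sqr_ge0.
have l2 : C * C * m4 * v ^+ 2 <= C * C * m4 * V ^+ 2.
  by apply: ler_wpM2l v2; exact: (mulr_ge0 (mulr_ge0 C0 C0) m4_0).
(* The block has [2 * N] coordinates, so [76 = 19 * 2^2]; it remains to replace [v] by its bound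
   [V]. *)
rewrite [leLHS](_ : _ = 76 * (64 * (C ^+ 2 * (m8 + v ^+ 4)) +
    128 * ((8 * v ^+ 2 + 3 * m4) * C * C * m4)) * N%:R ^+ 2); last by ring.
apply: ler_wpM2r; first exact: sqr_ge0.
by move: l1 l2; clearbody C m4 m8; lra.
Qed.

End Deviation.

(** * The fixed-point equation *)

Section FixedPoint.
Context {R : realType}.
Implicit Types (phi beta g : R) (s : seq R).

(* The fixed-point equation multiplied by [g], rearranged so as to increase with [g]. *)
Definition balance phi beta s g : R :=
  beta * g + \sum_(x <- s) phi * (g * x) / (phi + g * x).

Lemma sinr_rhs_balance N phi beta s g : 0 < phi -> 0 < g -> all (fun x => 0 < x) s ->
  beta = sinr_rhs N phi s g <-> balance phi beta s g = N%:R * phi.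
Proof.
move=> phi0 g0 s0.
have e : g * sinr_rhs N phi s g = N%:R * phi - \sum_(x <- s) phi * (g * x) / (phi + g * x).
  rewrite /sinr_rhs mulrBr mulrC divfK ?gt_eqF//; congr (_ - _).
  rewrite mulr_sumr !big_seq; apply: eq_bigr => x /(allP s0) x0.
  have gx : 0 < g * x by rewrite mulr_gt0.
  have : phi + g * x != 0 by rewrite gt_eqF// addr_gt0.
  by move=> h; field; rewrite h gt_eqF.
rewrite /balance; split=> [->|h]; first by rewrite mulrC e; ring.
apply: (@mulfI _ g); first by rewrite gt_eqF.
by rewrite e -h; ring.
Qed.

Lemma balance_lt phi beta s g1 g2 : 0 < phi -> 0 < beta -> all (fun x => 0 < x) s ->
  0 <= g1 -> g1 < g2 -> balance phi beta s g1 < balance phi beta s g2.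
Proof.
move=> phi0 beta0 s0 g10 g12; rewrite /balance ltr_leD// ?ltr_pM2l//.
rewrite !big_seq; apply: ler_sum => x /(allP s0) x0.
have g20 : 0 <= g2 by rewrite ltW// (le_lt_trans g10).
have h1 : 0 < phi + g1 * x by rewrite ltr_pwDl// mulr_ge0// ltW.
have h2 : 0 < phi + g2 * x by rewrite ltr_pwDl// mulr_ge0// ltW.
rewrite ler_pdivrMr// mulrAC ler_pdivlMr// -subr_ge0.
have -> : phi * (g2 * x) * (phi + g1 * x) - phi * (g1 * x) * (phi + g2 * x) =
  phi ^+ 2 * x * (g2 - g1) by ring.
by rewrite !mulr_ge0 ?sqr_ge0// ?subr_ge0 ltW.
Qed.

Lemma continuous_balance phi beta s g : 0 < phi -> all (fun x => 0 < x) s -> 0 <= g ->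
  {for g, continuous (balance phi beta s)}.
Proof.
move=> phi0 s0 g0; apply: cvgD; first by apply: cvgM; [exact: cvg_cst|exact: cvg_id].
elim: s s0 => [_|x s IH /= /andP[x0 s0]].
  by under eq_fun do rewrite big_nil; rewrite big_nil; exact: cvg_cst.
rewrite big_cons (_ : (fun g => \sum_(y <- x :: s) _) = (fun g => phi * (g * x) / (phi + g * x) +
    \sum_(y <- s) phi * (g * y) / (phi + g * y))); last first.
  by apply/funext => h; rewrite big_cons.
apply: cvgD; last exact: IH.
have cx : (fun h : R => h * x) h @[h --> g] --> g * x.
  by apply: cvgM; [exact: cvg_id|exact: cvg_cst].
apply: cvgM; first by apply: cvgM; [exact: cvg_cst|].
apply: cvgV; last by apply: cvgD => //; exact: cvg_cst.
by rewrite gt_eqF// ltr_pwDl// mulr_ge0// ltW.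
Qed.

Lemma sinr_fixed_point N phi beta s : (0 < N)%N -> 0 < phi -> 0 < beta ->
  all (fun x => 0 < x) s -> exists! g, 0 < g /\ beta = sinr_rhs N phi s g.
Proof.
move=> N0 phi0 beta0 s0; have Np : 0 < N%:R * phi by rewrite mulr_gt0// ltr0n.
(* [M] is the solution without interferers: there [beta * g] alone reaches the target, so the root
   lies between [0] and [M]. *)
pose M := N%:R * phi / beta; have M0 : 0 < M by rewrite divr_gt0.
have b0 : balance phi beta s 0 = 0.
  rewrite /balance mulr0 add0r big1// => x _.
  by rewrite !mul0r mulr0 mul0r.
have bM : N%:R * phi <= balance phi beta s M.
  have eM : beta * M = N%:R * phi by rewrite /M mulrC divfK ?gt_eqF.
  rewrite /balance eM lerDl big_seq; apply: sumr_ge0 => x /(allP s0) x0.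
  have x1 : 0 <= M * x by rewrite mulr_ge0// ltW.
  exact: divr_ge0 (mulr_ge0 (ltW phi0) x1) (addr_ge0 (ltW phi0) x1).
have [g gM gE] : exists2 g, g \in `[0, M] & balance phi beta s g = N%:R * phi.
  apply: IVT; first exact: ltW.
    apply: continuous_in_subspaceT => x; rewrite inE/= in_itv/= => /andP[x0 _].
    exact: continuous_balance.
  rewrite b0 ge_min le_max bM orbT andbT; apply/orP; left; exact: ltW.
have g0 : 0 < g.
  rewrite lt_def; move: gM; rewrite in_itv/= => /andP[-> _]; rewrite andbT.
  by apply/eqP => g0; move: gE; rewrite g0 b0 => /esym/eqP; rewrite gt_eqF.
exists g; split; first by split=> //; apply/sinr_rhs_balance.
move=> h [h0 /(sinr_rhs_balance _ _ phi0 h0 s0) hE].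
have [gh|hg|//] := ltgtP g h.
  by have := balance_lt phi0 beta0 s0 (ltW g0) gh; rewrite gE hE ltxx.
by have := balance_lt phi0 beta0 s0 (ltW h0) hg; rewrite gE hE ltxx.
Qed.

Lemma sinr_rhs_complex N phi s g :
  sinr_rhs N phi%:C [seq x%:C | x <- s] g%:C = (sinr_rhs N phi s g)%:C.
Proof.
rewrite /sinr_rhs rmorphB rmorphM fmorphV rmorphM rmorph_nat rmorph_sum big_map.
congr (_ - _); apply: eq_bigr => x _.
by rewrite rmorphM fmorphV rmorphD rmorph1 rmorphM fmorphV rmorphM.
Qed.

(** [echeck_k] is genuinely complex, but it enters [phi_k] multiplied by the conjugate of [a], which
    leaves [|a|^2]. Since [|a| < 1], the numerator [e] and the denominator [D] are positive. *)
Lemma model_coefs_real (alpha P c s : R) (a : R[i]) :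
  0 < alpha -> 0 < P -> 0 < c -> 0 < s -> `|a| < 1 ->
  exists p z : R, [/\ 0 < p, 0 < z, phi_k alpha P c s a = p%:C & z_k c s a = z%:C].
Proof.
move=> al0 P0 c0 s0 a1.
pose n : R := complex.Re a ^+ 2 + complex.Im a ^+ 2.
have aE : `|a| ^+ 2 = n%:C by rewrite add_Re2_Im2.
have n0 : 0 <= n by rewrite addr_ge0 ?sqr_ge0.
have n1 : n < 1.
  move: a1; rewrite normc_def -/n (_ : 1 = (1 : R)%:C)// ltcR => h.
  by rewrite -(sqr_sqrtr n0) expr_lt1.
pose D := (c + s) ^+ 2 - n * c ^+ 2; pose e := c + s - n * c.
have nc : n * c < c by rewrite gtr_pMl.
have e0 : 0 < e by rewrite /e; lra.
have D0 : 0 < D.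
  have : n * c ^+ 2 < c ^+ 2 by rewrite gtr_pMl// exprn_gt0.
  have : 0 < c * s by rewrite mulr_gt0.
  have : 0 < s ^+ 2 by rewrite exprn_gt0.
  rewrite /D => ? ? ?; lra.
have denE : den_k c s a = D%:C by rewrite /den_k aE -rmorphM -rmorphB.
have numE : (c + s)%:C - `|a| ^+ 2 * c%:C = e%:C by rewrite aE -rmorphM -rmorphB.
exists (alpha ^+ 2 * P * (c * e / D * c + n * (c * s) / D * c)), (c * s * e / D).
split.
- rewrite mulr_gt0 ?mulr_gt0 ?exprn_gt0// ltr_pwDl//.
    by rewrite mulr_gt0// divr_gt0// mulr_gt0.
  by rewrite mulr_ge0 ?divr_ge0 ?mulr_ge0// ltW.
- by rewrite divr_gt0// !mulr_gt0.
- rewrite /phi_k /ehat_k /echeck_k denE numE.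
  have -> : a * (c * s)%:C / D%:C * c%:C * a^* = n%:C * (c * s)%:C / D%:C * c%:C.
    by rewrite -aE sqr_normc; ring.
  by rewrite -fmorphV -!rmorphM -!rmorphD -!rmorphM.
- by rewrite /z_k denE numE -fmorphV -!rmorphM.
Qed.

Lemma system_fixed_point (K Nr taup : nat) (sp2 sd2 : R) (alpha P Pp c : nat -> R)
    (a : nat -> R[i]) :
  (1 <= K)%N -> (K <= Nr)%N -> (1 <= taup)%N -> 0 < sp2 -> 0 < sd2 ->
  (forall k, (1 <= k <= K)%N ->
     [/\ 0 < alpha k, 0 < P k, 0 < Pp k, 0 < c k & `|a k| < 1]) ->
  let s k := s_k sp2 (alpha k) (Pp k) taup in
  let phik k := phi_k (alpha k) (P k) (c k) (s k) (a k) in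
  let beta := \sum_(1 <= k < K.+1) (alpha k ^+ 2 * P k)%:C * z_k (c k) (s k) (a k)
              + sd2%:C in
  exists! g : R, 0 < g /\
    beta = sinr_rhs Nr (phik 1%N) [seq phik k | k <- iota 2 K.-1] g%:C.
Proof.
move=> K1 KN t1 sp0 sd0 H s phik beta.
pose p k := complex.Re (phik k); pose z k := complex.Re (z_k (c k) (s k) (a k)).
have pz k : (1 <= k <= K)%N ->
    [/\ 0 < p k, 0 < z k, phik k = (p k)%:C & z_k (c k) (s k) (a k) = (z k)%:C].
  move=> kK; have [al0 P0 Pp0 c0 a1] := H k kK.
  have s0 : 0 < s k.
    by rewrite /s /s_k divr_gt0// !mulr_gt0 ?exprn_gt0// ltr0n.
  have [x [y [x0 y0 xE yE]]] := model_coefs_real al0 P0 c0 s0 a1.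
  by rewrite /p /z /phik xE yE.
pose B := \sum_(1 <= k < K.+1) (alpha k ^+ 2 * P k) * z k + sd2.
have betaE : beta = B%:C.
  rewrite /beta /B rmorphD rmorph_sum; congr (_ + _).
  rewrite big_nat_cond [RHS]big_nat_cond; apply: eq_bigr => k /andP[/andP[k1 kK] _].
  have kk : (1 <= k <= K)%N by rewrite k1.
  by have [_ _ _ ->] := pz k kk; rewrite [RHS]rmorphM.
have B0 : 0 < B.
  rewrite ltr_pwDr// big_nat_cond; apply: sumr_ge0 => k /andP[/andP[k1 kK] _].
  have kk : (1 <= k <= K)%N by rewrite k1.
  have [_ z0 _ _] := pz k kk; have [al0 P0 _ _ _] := H k kk.
  by rewrite !mulr_ge0 ?sqr_ge0// ltW.
have k1K : (1 <= 1 <= K)%N by [].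
have [p0 _ phi1 _] := pz 1%N k1K.
have iK k : k \in iota 2 K.-1 -> (1 <= k <= K)%N.
  by rewrite mem_iota; case: (K) K1 => //= K' _ /andP[k2 kK]; rewrite (ltnW k2).
have mapE : [seq phik k | k <- iota 2 K.-1] = [seq x%:C | x <- [seq p k | k <- iota 2 K.-1]].
  by rewrite -map_comp; apply/eq_in_map => k /iK kK /=; have [] := pz k kK.
have ps : all (fun x => 0 < x) [seq p k | k <- iota 2 K.-1].
  by rewrite all_map; apply/allP => k /iK kK /=; have [] := pz k kK.
have [g [[g0 gE] gU]] := sinr_fixed_point (leq_trans K1 KN) p0 B0 ps.
exists g; split; first by split=> //; rewrite betaE phi1 mapE sinr_rhs_complex -gE.
move=> h [h0]; rewrite betaE phi1 mapE sinr_rhs_complex => /complexI hE.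
exact: gU.
Qed.

End FixedPoint.

(** * The SINR at a fixed number of antennas *)

Section FixedSize.
Context {d} {T : measurableType d} {R : realType} (P : probability T R).
Variables (N m : nat) (phi : R) (phis : 'I_m -> R) (beta lo hi : R).
Variables (b : T -> 'cV[R[i]]_N) (bs : 'I_m -> T -> 'cV[R[i]]_N).
Hypothesis lo_gt0 : 0 < lo.
Hypothesis phi_bnd : lo <= phi <= hi.
Hypothesis phis_bnd : forall k, lo <= phis k <= hi.
Hypothesis beta_bnd : lo <= beta <= hi.
Hypothesis model : CN_model P phi phis b bs.
Hypotheses (N_gt0 : (0 < N)%N) (mN : (m <= N)%N).

(** Has the exact shape produced by [rform_leave_one_out] at [predT]. *)
Definition but (k : 'I_m) : pred 'I_m := [pred l | predT l && (l != k)].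

Definition dev w := deviation beta bs predT b phi w.
Definition dev_other k w := deviation beta bs (but k) (bs k) (phis k) w.

(** The only random quantity left in the final error bound [sinr_gap]. Its second term averages over
    the [m <= N] interferers, so its mean is of the same order [N^-2] as that of the first. *)
Definition fluctuation w : R :=
  (dev w / N%:R) ^+ 4 + N%:R^-1 * \sum_(k < m) (dev_other k w / N%:R) ^+ 4.

Let beta_gt0 : 0 < beta. Proof. by case/andP: beta_bnd => h _; exact: lt_le_trans h. Qed.
Let N0 : 0 < N%:R :> R. Proof. by rewrite ltr0n. Qed.

Lemma dev_moments : all_moments P dev /\
  Ex P (fun w => dev w ^+ 4) <= deviation_bound lo hi * N%:R ^+ 2.
Proof.
apply: (@deviation_moments _ _ _ P N m phi phis beta lo hi b bs lo_gt0 beta_bnd model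
  predT inl (fun i => match i with inl x => Some x | inr _ => None end)) => //.
Qed.

Lemma dev_other_moments k : all_moments P (dev_other k) /\
  Ex P (fun w => dev_other k w ^+ 4) <= deviation_bound lo hi * N%:R ^+ 2.
Proof.
apply: (@deviation_moments _ _ _ P N m phi phis beta lo hi b bs lo_gt0 beta_bnd model
  (but k) (fun x => inr (k, x.1, x.2)) (fun i => match i with
    | inr (k', j, c) => if k' == k then Some (j, c) else None | _ => None end)) => //.
- by move=> [j c] /=; rewrite eqxx.
- move=> l j c [j' c'] /=; rewrite /but/= => lk.
  by apply: contra lk => /eqP[-> _ _].
Qed.

Lemma fluctuation_ge0 w : 0 <= fluctuation w.
Proof.
have p4 (x : R) : 0 <= x ^+ 4 by rewrite (exprM x 2 2) sqr_ge0.
by rewrite addr_ge0// mulr_ge0// ?invr_ge0 ?sumr_ge0.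
Qed.

Lemma fluctuation_moments : all_moments P fluctuation /\
  Ex P fluctuation <= 2 * deviation_bound lo hi / N%:R ^+ 2.
Proof.
have [a0 E0] := dev_moments.
have ak k := (dev_other_moments k).1; have Ek k := (dev_other_moments k).2.
have s4 Y : all_moments P Y -> all_moments P (fun w => (Y w / N%:R) ^+ 4).
  by move=> aY; apply: all_momentsX; apply: all_momentsM => //; exact: all_moments_cst.
have e4 Y : all_moments P Y ->
    Ex P (fun w => Y w ^+ 4) <= deviation_bound lo hi * N%:R ^+ 2 ->
    Ex P (fun w => (Y w / N%:R) ^+ 4) <= deviation_bound lo hi / N%:R ^+ 2.
  move=> aY EY; rewrite (_ : (fun w => _) = (fun w => N%:R ^- 4 * Y w ^+ 4)); last first.
    by apply/funext => w; rewrite exprMn exprVn mulrC.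
  rewrite ExZ; last exact: all_momentsX.
  apply: (@le_trans _ _ (N%:R ^- 4 * (deviation_bound lo hi * N%:R ^+ 2))).
    by rewrite ler_wpM2l// invr_ge0 exprn_ge0.
  by rewrite le_eqVlt; apply/orP; left; apply/eqP; field; rewrite gt_eqF.
have aS : all_moments P (fun w => \sum_(k < m) (dev_other k w / N%:R) ^+ 4).
  by apply: all_moments_sum => k _; exact: s4.
split.
  apply: all_momentsD; first exact: s4.
  by apply: all_momentsZ.
have B0 : 0 <= deviation_bound lo hi / N%:R ^+ 2.
  by apply: le_trans (e4 _ a0 E0); apply: Ex_ge0 => w; rewrite (exprM _ 2 2) sqr_ge0.
rewrite /fluctuation ExD; [|exact: s4|exact: all_momentsZ].
rewrite ExZ// Ex_sum; last by move=> k; exact: s4.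
have h1 := e4 _ a0 E0.
pose q := deviation_bound lo hi / N%:R ^+ 2; rewrite -/q in B0.
have Eq k : Ex P (fun w => (dev_other k w / N%:R) ^+ 4) <= q := e4 _ (ak k) (Ek k).
have h2 : N%:R^-1 * \sum_(k < m) Ex P (fun w => (dev_other k w / N%:R) ^+ 4) <= q.
  apply: (@le_trans _ _ (N%:R^-1 * (m%:R * q))).
    apply: ler_wpM2l; first by rewrite invr_ge0 ler0n.
    apply: (@le_trans _ _ (\sum_(k < m) q)); first by apply: ler_sum => k _; exact: Eq.
    by rewrite sumr_const card_ord mulr_natl.
  rewrite mulrA -[leRHS]mul1r; apply: ler_wpM2r => //.
  by rewrite mulrC ler_pdivrMr// mul1r ler_nat.
rewrite (_ : 2 * deviation_bound lo hi / N%:R ^+ 2 =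
  deviation_bound lo hi / N%:R ^+ 2 + deviation_bound lo hi / N%:R ^+ 2); last by ring.
exact: lerD.
Qed.

Definition sinr w : R := rform beta (fun k => bs k w) predT (b w).

Lemma sinr_mmseE w : sinr_mmse beta (b w) (fun k => bs k w) = (sinr w)%:C.
Proof. by have [<- _] := resolvent_form (fun k => bs k w) beta_gt0 predT (b w). Qed.

Let trace Q w : R := complex.Re (\tr (resolvent beta (fun k => bs k w) Q)).

Let rform_le1 (Q : pred 'I_m) w k : Q k -> rform beta (fun k => bs k w) Q (bs k w) <= 1.
Proof.
move=> Qk; rewrite rform_leave_one_out// gerBl invr_ge0 addr_ge0//.
exact: rform_ge0.
Qed.

(** In [resolvent_trace] each user takes away at most [1], by [rform_le1]. As [Q] is arbitrary, the
    bound also serves the matrices with one user removed. *)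
Lemma trace_lower Q w : N%:R - m%:R <= beta * trace Q w.
Proof.
have := resolvent_trace (fun k => bs k w) beta_gt0 Q.
have : \sum_(k < m | Q k) rform beta (fun k => bs k w) Q (bs k w) <= m%:R.
  apply: (@le_trans _ _ (\sum_(k < m) 1)); last by rewrite sumr_const card_ord.
  rewrite big_mkcond; apply: ler_sum => k _; case: ifP => // Qk; exact: rform_le1.
rewrite -/(trace Q w); lra.
Qed.

Lemma trace_upper Q w : beta * trace Q w <= N%:R.
Proof.
have := resolvent_trace (fun k => bs k w) beta_gt0 Q.
have : 0 <= \sum_(k < m | Q k) rform beta (fun k => bs k w) Q (bs k w).
  by apply: sumr_ge0 => k _; exact: rform_ge0.
rewrite -/(trace Q w); lra.
Qed.

Definition loo_sum w := \sum_(k < m) (1 + rform beta (fun k => bs k w) (but k) (bs k w))^-1.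

Lemma trace_loo w : beta * trace predT w = N%:R - m%:R + loo_sum w.
Proof.
have := resolvent_trace (fun k => bs k w) beta_gt0 predT.
rewrite (eq_bigr (fun k => 1 - (1 + rform beta (fun k => bs k w) (but k) (bs k w))^-1)).
  rewrite sumrB sumr_const card_ord -/(loo_sum w) -/(trace predT w); lra.
by move=> k _; rewrite rform_leave_one_out.
Qed.

(** The SINR is its deviation, already controlled, plus [phi] times a bounded trace. *)
Lemma sinr_moments : all_moments P sinr.
Proof.
have mb k j : cmeasurable (fun w => bs k w j ord0).
  split; first exact: (model.1.1 (inr (k, j, false))).
  exact: (model.1.1 (inr (k, j, true))).
have mt : measurable_fun [set: T] (trace predT).
  suff [] : cmeasurable (fun w => \tr (resolvent beta (fun k => bs k w) predT)) by [].
  by apply: cmeasurable_sum => i _; apply: cmeasurable_resolvent.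
rewrite (_ : sinr = (fun w => dev w + phi * trace predT w)); last first.
  by apply/funext => w; rewrite /dev /deviation subrK.
apply: all_momentsD; first exact: dev_moments.1.
apply: all_momentsZ; apply: (@all_moments_bounded _ _ _ _ _ (N%:R / beta)) => // w.
have mN' : m%:R <= N%:R :> R by rewrite ler_nat.
have h1 := trace_lower predT w; have h2 := trace_upper predT w.
rewrite ler_norml; apply/andP; split.
  rewrite -mulNr ler_pdivrMr// mulrC; move: N0 h1 mN'; lra.
by rewrite ler_pdivlMr// mulrC.
Qed.

Variables (gbar delta : R).
Hypothesis gbar_gt0 : 0 < gbar.
Hypothesis gbarE : beta = sinr_rhs N phi [seq phis k | k <- enum 'I_m] gbar.
Hypotheses (delta_gt0 : 0 < delta) (delta_le : delta * N%:R <= N%:R - m%:R).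

(** A lower bound per antenna: a covariance is at least [lo] and a trace at least [delta * N / hi].
    The same [c] bounds [gbar / N] from below. *)
Let c := lo * delta / hi.

Let phi_gt0 : 0 < phi. Proof. by case/andP: phi_bnd => h _; exact: lt_le_trans h. Qed.
Let phis_gt0 k : 0 < phis k.
Proof. by case/andP: (phis_bnd k) => h _; exact: lt_le_trans h. Qed.
Let hi_gt0 : 0 < hi.
Proof. by case/andP: phi_bnd => h1 h2; rewrite (lt_le_trans lo_gt0)// (le_trans h1). Qed.
Let c_gt0 : 0 < c. Proof. by rewrite divr_gt0// mulr_gt0. Qed.
Let mN' : m%:R <= N%:R :> R. Proof. by rewrite ler_nat. Qed.

Let ratio_ge (x y : R) : lo <= x -> beta * y >= delta * N%:R -> c * N%:R <= x * y.
Proof.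
move=> xlo hy; have y0 : 0 <= y.
  by rewrite -(pmulr_rge0 _ beta_gt0) (le_trans _ hy)// mulr_ge0// ltW.
apply: (@le_trans _ _ (lo * y)); last by rewrite ler_wpM2r.
have -> : c * N%:R = lo * (delta * N%:R / hi) by rewrite /c; ring.
rewrite ler_pM2l// ler_pdivrMr//.
apply: le_trans hy _; rewrite mulrC ler_wpM2l//.
by case/andP: beta_bnd.
Qed.

Let hi_lo (x y : R) : 0 <= x -> x <= hi -> lo <= y -> x / y <= hi / lo.
Proof.
move=> x0 xh yl; have y0 : 0 < y by exact: lt_le_trans yl.
by apply: ler_pM; rewrite ?invr_ge0 ?(ltW y0)// lef_pV2 ?posrE.
Qed.

Let sum_le_avg (x : R) : 0 <= x -> \sum_(k < m) (x / N%:R) <= x.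
Proof.
move=> x0; rewrite sumr_const card_ord -[_ *+ m]mulr_natl mulrCA -[leRHS]mulr1.
by apply: ler_wpM2l => //; rewrite ler_pdivrMr// mul1r.
Qed.

(* Either [dev_other k] is at most half of the trace term, and the leave-one-out SINR is
   of order [N], or [1 <= (2 * dev_other k / (c * N)) ^ 4]. *)
Lemma loo_sum_le w : loo_sum w <= 2 / c +
  16 / c ^+ 4 * \sum_(k < m) (dev_other k w / N%:R) ^+ 4.
Proof.
apply: (@le_trans _ _ (\sum_(k < m) (2 / (c * N%:R) + 16 / c ^+ 4 * (dev_other k w / N%:R) ^+ 4))).
  apply: ler_sum => k _; set g := rform _ _ _ _.
  have g0 : 0 <= g by exact: rform_ge0.
  have gE : g = dev_other k w + phis k * trace (but k) w by rewrite /dev_other /deviation subrK.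
  have cg : c * N%:R <= phis k * trace (but k) w.
    apply: ratio_ge; first by case/andP: (phis_bnd k).
    by apply: le_trans delta_le _; exact: trace_lower.
  have cN : 0 < c * N%:R by rewrite mulr_gt0.
  have p4 : 0 <= 16 / c ^+ 4 * (dev_other k w / N%:R) ^+ 4.
    apply: mulr_ge0; first by rewrite divr_ge0// exprn_ge0// ltW.
    by rewrite (exprM _ 2 2) sqr_ge0.
  have [small|big] := leP `|dev_other k w| (c * N%:R / 2).
    apply: (@le_trans _ _ (2 / (c * N%:R))); last by rewrite lerDl.
    rewrite -[leRHS]invrK invf_div lef_pV2 ?posrE ?divr_gt0// ?ltr_pwDl//.
    have := ler_norm (- dev_other k w); rewrite normrN; move: small cg; rewrite gE; lra.
  apply: (@le_trans _ _ 1); first by rewrite invf_le1 ?ltr_pwDl// lerDl.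
  apply: (@le_trans _ _ (16 / c ^+ 4 * (dev_other k w / N%:R) ^+ 4)); last first.
    by rewrite lerDr divr_ge0// ltW.
  have -> : 16 / c ^+ 4 * (dev_other k w / N%:R) ^+ 4 = (`|dev_other k w| / (c * N%:R / 2)) ^+ 4.
    rewrite [RHS]expr_div_n (_ : `|_| ^+ 4 = dev_other k w ^+ 4).
      by field; rewrite !gt_eqF.
    by rewrite (exprM _ 2 2) real_normK ?num_real// -exprM.
  rewrite exprn_ege1// ler_pdivlMr ?divr_gt0// mul1r; exact: ltW.
rewrite big_split/= mulr_sumr; apply: lerD => //.
rewrite (eq_bigr (fun=> 2 / c / N%:R)); last by move=> k _; rewrite invfM mulrA.
by apply: sum_le_avg; rewrite divr_ge0// ltW.
Qed.

Let gsum := \sum_(k < m) (1 + gbar * phis k / phi)^-1.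

(** Deterministic counterpart of [trace_loo], from [x / (1 + x) = 1 - 1 / (1 + x)] in each summand;
    the two are subtracted in [sinr_gap]. *)
Lemma gbar_eq : beta * gbar = (N%:R - m%:R) * phi + phi * gsum.
Proof.
have s0 : all (fun x => 0 < x) [seq phis k | k <- enum 'I_m].
  by rewrite all_map; apply/allP => k _ /=.
have := (sinr_rhs_balance N beta phi_gt0 gbar_gt0 s0).1 gbarE.
rewrite /balance big_map big_enum/=.
have -> : \sum_(k < m) phi * (gbar * phis k) / (phi + gbar * phis k) = phi * (m%:R - gsum).
  rewrite /gsum (_ : m%:R = \sum_(k < m) 1); last by rewrite sumr_const card_ord.
  rewrite -sumrB mulr_sumr; apply: eq_bigr => k _.
  have gx : 0 < gbar * phis k by rewrite mulr_gt0.
  have : phi + gbar * phis k != 0 by rewrite gt_eqF// addr_gt0.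
  by move=> h; field; rewrite h gt_eqF.
lra.
Qed.

Lemma gsum_ge0 : 0 <= gsum.
Proof.
apply: sumr_ge0 => k _; rewrite invr_ge0 addr_ge0// divr_ge0 ?mulr_ge0//; exact: ltW.
Qed.

(** Two passes through [gbar_eq] avoid circularity: dropping [gsum >= 0] gives [c * N <= gbar],
    which then makes each of the [m <= N] terms of order [1 / N]. *)
Lemma gsum_le : gsum <= hi / lo / c.
Proof.
have gc : c * N%:R <= gbar.
  have h : delta * N%:R * phi <= beta * gbar.
    rewrite gbar_eq; apply: (@le_trans _ _ ((N%:R - m%:R) * phi)).
      by rewrite ler_wpM2r// ltW.
    by rewrite lerDl mulr_ge0 ?gsum_ge0// ltW.
  have e : phi * (gbar / phi) = gbar by field; rewrite gt_eqF.
  rewrite -e; apply: ratio_ge; first by case/andP: phi_bnd.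
  by rewrite mulrA ler_pdivlMr.
apply: (@le_trans _ _ (\sum_(k < m) hi / lo / (c * N%:R))).
  apply: ler_sum => k _.
  apply: (@le_trans _ _ ((gbar * phis k / phi)^-1)).
    have x0 : 0 < gbar * phis k / phi by rewrite divr_gt0 ?mulr_gt0.
    by rewrite lef_pV2 ?posrE ?addr_gt0// lerDr.
  rewrite invf_div invfM mulrCA mulrC; apply: ler_pM.
  - by rewrite divr_ge0// ltW.
  - by rewrite invr_ge0 ltW.
  - by apply: hi_lo; [exact: ltW|case/andP: phi_bnd|case/andP: (phis_bnd k)].
  - by rewrite lef_pV2 ?posrE// mulr_gt0.
rewrite (eq_bigr (fun=> hi / lo / c / N%:R)); last by move=> k _; rewrite invfM !mulrA.
apply: sum_le_avg.
exact: divr_ge0 (divr_ge0 (ltW hi_gt0) (ltW lo_gt0)) (ltW c_gt0).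
Qed.

(** A pointwise inequality, so it yields the almost sure limit as it stands and the limit in mean
    after integration. *)
Lemma sinr_gap (eps : R) w : 0 < eps ->
  `|sinr w - gbar| / N%:R <= eps +
   (eps ^- 3 + hi / lo * (16 / c ^+ 4)) * fluctuation w +
   (hi / lo * (2 / c + hi / lo / c)) * N%:R^-1.
Proof.
move=> eps0.
have dE : sinr w = dev w + phi * trace predT w by rewrite /dev /deviation subrK.
have tE := trace_loo w.
(* The leading terms [(N - m) * phi / beta] of the two quantities cancel exactly. *)
have gapE : sinr w - gbar = dev w + phi / beta * (loo_sum w - gsum).
  have -> : gbar = ((N%:R - m%:R) * phi + phi * gsum) / beta.
    by rewrite -gbar_eq [beta * _]mulrC mulfK// gt_eqF.
  have -> : sinr w = dev w + phi * ((N%:R - m%:R + loo_sum w) / beta).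
    by rewrite dE -tE [beta * _]mulrC mulfK ?gt_eqF.
  by field; rewrite gt_eqF.
have l0 : 0 <= loo_sum w.
  by apply: sumr_ge0 => k _; rewrite invr_ge0 addr_ge0//; exact: rform_ge0.
have h1 : `|sinr w - gbar| <= `|dev w| + hi / lo * (loo_sum w + gsum).
  rewrite gapE; apply: le_trans (ler_normD _ _) _; rewrite lerD2l normrM.
  apply: ler_pM => //.
    rewrite ger0_norm; last by rewrite divr_ge0// ltW.
    by apply: hi_lo; [exact: ltW|case/andP: phi_bnd|case/andP: beta_bnd].
  apply: le_trans (ler_normB _ _) _.
  by rewrite !ger0_norm// gsum_ge0.
have h2 := loo_sum_le w; have h3 := gsum_le.
set x := dev w / N%:R.
(* The free [eps] trades the first power for the fourth, the one whose mean is controlled: above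
   [eps], the factor [(|x| / eps)^3] is at least [1]. *)
have hx : `|dev w| / N%:R <= eps + eps ^- 3 * x ^+ 4.
  have -> : `|dev w| / N%:R = `|x| by rewrite /x normrM normfV (ger0_norm (ltW N0)).
  have e3 : 0 < eps ^- 3 by rewrite invr_gt0 exprn_gt0.
  have -> : x ^+ 4 = `|x| ^+ 4 by rewrite (exprM `|x| 2 2) real_normK ?num_real// -exprM.
  have [xe|xe] := leP `|x| eps.
    by apply: (le_trans xe); rewrite lerDl; apply: mulr_ge0; [exact: ltW|rewrite exprn_ge0].
  apply: (@le_trans _ _ (eps ^- 3 * `|x| ^+ 4)); last by rewrite lerDr ltW.
  rewrite mulrC ler_pdivlMr ?exprn_gt0// [leRHS]exprS; apply: ler_wpM2l => //.
  by apply: lerXn2r; rewrite ?nnegrE//; exact: ltW.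
set S := \sum_(k < m) _ in h2.
have S0 : 0 <= S by apply: sumr_ge0 => k _; rewrite (exprM _ 2 2) sqr_ge0.
have hl0 : 0 <= hi / lo by rewrite divr_ge0// ltW.
apply: (@le_trans _ _ ((`|dev w| + hi / lo * (loo_sum w + gsum)) / N%:R)).
  by rewrite ler_pM2r ?invr_gt0.
rewrite mulrDl.
have h4 : hi / lo * (loo_sum w + gsum) / N%:R <=
    hi / lo * (2 / c + 16 / c ^+ 4 * S + hi / lo / c) / N%:R.
  by rewrite ler_pM2r ?invr_gt0// ler_wpM2l// lerD.
apply: le_trans (lerD hx h4) _; rewrite /fluctuation -/x -/S.
have q0 : 0 <= hi / lo * (16 / c ^+ 4) * x ^+ 4.
  apply: mulr_ge0; last by rewrite (exprM x 2 2) sqr_ge0.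
  by rewrite mulr_ge0// divr_ge0// exprn_ge0// ltW.
have q1 : 0 <= eps ^- 3 * (N%:R^-1 * S).
  apply: mulr_ge0; first by rewrite invr_ge0 exprn_ge0// ltW.
  by rewrite mulr_ge0// invr_ge0 ler0n.
move: q0 q1; move: (x ^+ 4) (N%:R^-1) (eps ^- 3) (hi / lo) (16 / c ^+ 4) (c^-1) (S).
move=> *; lra.
Qed.

End FixedSize.

(** * Limits *)

Section Limits.
Context {R : realType}.

(** [eps] is fixed before [n] grows, so [A eps] may blow up as [eps] tends to [0]. *)
Lemma cvg0_epsilon_bound (x z : nat -> R) (A : R -> R) (A' : R) :
  z @ \oo --> (0 : R) ->
  (forall eps : R, 0 < eps -> \forall n \near \oo,
     `|x n| <= eps + A eps * z n + A' * n.+1%:R^-1) ->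
  x @ \oo --> (0 : R).
Proof.
move=> z0 xz; apply/cvgr0Pnorm_le => e e0.
have e2 : 0 < e / 2 by rewrite divr_gt0.
have r0 : (fun n => A (e / 2) * z n + A' * n.+1%:R^-1) @ \oo --> (0 : R).
  rewrite -[X in _ --> X](_ : A (e / 2) * 0 + A' * 0 = 0); last by rewrite !mulr0 addr0.
  apply: cvgD; apply: cvgM => //; first exact: cvg_cst.
    exact: cvg_cst.
  exact: cvg_harmonic.
have hr := (cvgr0Pnorm_le _).1 r0 _ e2.
near=> n.
have h1 : `|x n| <= e / 2 + A (e / 2) * z n + A' * n.+1%:R^-1 by near: n; exact: xz.
have h2 : `|A (e / 2) * z n + A' * n.+1%:R^-1| <= e / 2.
  by near: n; exact: hr.
have h3 := le_trans (ler_norm _) h2.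
by apply: le_trans h1 _; rewrite -addrA [leRHS]splitr lerD2l.
Unshelve. all: by end_near. Qed.

Lemma sum_inv_sqr_le (B : R) n : 0 <= B ->
  \sum_(0 <= k < n) B / k.+1%:R ^+ 2 <= 2 * B.
Proof.
move=> B0.
(* The telescoping form, from [1 / (k + 1)^2 <= 2 / ((k + 1) * (k + 2))], is what the induction can
   carry. *)
suff h : \sum_(0 <= k < n) B / k.+1%:R ^+ 2 <= 2 * B * (1 - n.+1%:R^-1).
  by apply: le_trans h _; rewrite -[leRHS]mulr1 ler_wpM2l ?mulr_ge0.
elim: n => [|n IH]; first by rewrite big_geq// invr1 subrr mulr0.
rewrite big_nat_recr//=.
have k0 : 0 <= n%:R :> R by rewrite ler0n.
have -> : n.+2%:R = n%:R + 2 :> R by rewrite -addn2 natrD.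
have -> : n.+1%:R = n%:R + 1 :> R by rewrite -addn1 natrD.
have IH' : \sum_(0 <= i < n) B / i.+1%:R ^+ 2 <= 2 * B * (1 - (n%:R + 1)^-1).
  by move: IH; rewrite -[n.+1%:R]natr1.
move: (n%:R) k0 IH' => k k0 IH'.
have p1 : 0 < k + 1 by lra.
have p2 : 0 < k + 2 by lra.
have -> : 2 * B * (1 - (k + 2)^-1) = 2 * B * (1 - (k + 1)^-1) +
    B * (2 / ((k + 1) * (k + 2))) by field; rewrite !gt_eqF.
apply: lerD => //; apply: ler_wpM2l => //.
rewrite ler_pdivlMr ?mulr_gt0// mulrC ler_pdivrMr ?exprn_gt0//.
by have := sqr_ge0 k; lra.
Qed.

(** The sum of the nonnegative [Z n] has finite mean, so it is almost surely finite and its terms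
    tend to [0]. Only individual means enter, which suits a model that fixes no joint law across
    different [n]. *)
Lemma ae_cvg0_summable {d} {T : measurableType d} (P : probability T R)
    (Z : nat -> T -> R) (B : R) :
  (forall n, all_moments P (Z n)) -> (forall n w, 0 <= Z n w) ->
  (forall n, Ex P (Z n) <= B / n.+1%:R ^+ 2) ->
  {ae P, forall w, (fun n => Z n w) @ \oo --> (0 : R)}.
Proof.
move=> aZ Z0 EZ.
have B0 : 0 <= B.
  have := le_trans (Ex_ge0 P (Z0 0%N)) (EZ 0%N).
  by rewrite expr1n divr1.
have mZ n : measurable_fun [set: T] (fun w => (Z n w)%:E).
  by apply/measurable_EFinP; exact: (aZ n).1.
pose S w := (\sum_(n <oo) (Z n w)%:E)%E.
have S0 w : (0 <= S w)%E by apply: nneseries_ge0 => n _ _; rewrite lee_fin.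
have intS : (\int[P]_w S w <= (2 * B)%:E)%E.
  rewrite /S integral_nneseries//; last by move=> n w _; rewrite lee_fin.
  apply: lime_le.
    by apply: is_cvg_nneseries => n _ _; apply: integral_ge0 => w _; rewrite lee_fin.
  apply: nearW => n; under eq_bigr do rewrite EFin_Ex//.
  rewrite sumEFin lee_fin; apply: le_trans (sum_inv_sqr_le n B0).
  by apply: ler_sum => k _; exact: EZ.
have mS : measurable_fun [set: T] S.
  by apply: ge0_emeasurable_sum => // n w _ _; rewrite lee_fin.
have iS : P.-integrable [set: T] S.
  apply/integrableP; split=> //.
  under eq_integral do rewrite gee0_abs//.
  by apply: le_lt_trans intS _; exact: ltry.
apply: filterS (integrable_ae measurableT iS) => w /(_ I) Sfin.
apply: cvg_series_cvg_0; apply: nondecreasing_is_cvgn.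
  by apply: nondecreasing_series.
exists (fine (S w)) => _ [n _ <-].
rewrite -lee_fin fineK// /series/= -sumEFin.
by apply: nneseries_lim_ge => k _ _; rewrite lee_fin.
Qed.

End Limits.

(** * Conclusion: fixed point, almost sure convergence and convergence in mean *)

Theorem theorem2 (R : realType) :
  (* (i) existence and uniqueness of the positive solution of the
         fixed-point equation for the actual system parameters *)
  (forall (K Nr taup : nat) (sp2 sd2 : R) (alpha P Pp c : nat -> R)
          (a : nat -> R[i]),
     (1 <= K)%N -> (K <= Nr)%N -> (1 <= taup)%N -> 0 < sp2 -> 0 < sd2 ->
     (forall k, (1 <= k <= K)%N ->
        [/\ 0 < alpha k, 0 < P k, 0 < Pp k, 0 < c k & `|a k| < 1]) ->
     let s k := s_k sp2 (alpha k) (Pp k) taup in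
     let phik k := phi_k (alpha k) (P k) (c k) (s k) (a k) in
     let beta := \sum_(1 <= k < K.+1) (alpha k ^+ 2 * P k)%:C * z_k (c k) (s k) (a k)
                 + sd2%:C in
     exists! g : R, 0 < g /\
       beta = sinr_rhs Nr (phik 1%N) [seq phik k | k <- iota 2 K.-1] g%:C)
  /\
  (* (ii) asymptotic deterministic equivalent, N_r = n.+1 -> oo *)
  (forall (d : measure_display) (T : measurableType d) (Pr : probability T R)
          (K : nat -> nat) (phi : nat -> R) (phis : forall n, 'I_(K n).-1 -> R)
          (beta : nat -> R) (lo hi : R) (gbar : nat -> R)
          (b : forall n, T -> 'cV[R[i]]_n.+1)
          (bs : forall n, 'I_(K n).-1 -> T -> 'cV[R[i]]_n.+1),
     (forall n, (1 <= K n <= n.+1)%N) ->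
     (exists2 r : R, r < 1 & \forall n \near \oo, (K n)%:R <= r * n.+1%:R) ->
     0 < lo ->
     (forall n, lo <= phi n <= hi) ->
     (forall n k, lo <= phis n k <= hi) ->
     (forall n, lo <= beta n <= hi) ->
     (forall n, CN_model Pr (phi n) (phis n) (b n) (bs n)) ->
     (forall n, 0 < gbar n /\
        beta n = sinr_rhs n.+1 (phi n) [seq phis n k | k <- enum 'I_(K n).-1] (gbar n)) ->
     let gamma n w := sinr_mmse (beta n) (b n w) (fun k => bs n k w) in
     {ae Pr, forall w,
        (fun n => cmod (gamma n w - (gbar n)%:C) / n.+1%:R) @ \oo --> (0 : R)}
     /\ (forall n, ('E_Pr[fun w => complex.Re (gamma n w)] \is a fin_num)%E
                /\ ('E_Pr[fun w => complex.Im (gamma n w)] \is a fin_num)%E)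
     /\ (fun n => (fine 'E_Pr[fun w => complex.Re (gamma n w)] - gbar n) / n.+1%:R)
           @ \oo --> (0 : R)
     /\ (fun n => fine 'E_Pr[fun w => complex.Im (gamma n w)] / n.+1%:R)
           @ \oo --> (0 : R)).
Proof.
split; first by move=> *; exact: system_fixed_point.
move=> d T Pr K phi phis beta lo hi gbar b bs KN [r r1 Kr] lo0 phi_b phis_b beta_b
  model gbarP gamma.
have mN n : ((K n).-1 <= n.+1)%N.
  by case/andP: (KN n) => _; apply: leq_trans; exact: leq_pred.
pose Z n := fluctuation (phi n) (phis n) (beta n) (b n) (bs n).
pose g n := sinr (beta n) (b n) (bs n).
have gE n w : gamma n w = (g n w)%:C := sinr_mmseE _ _ lo0 (beta_b n) w.
have aZ n : all_moments Pr (Z n).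
  exact: (fluctuation_moments lo0 (phi_b n) (phis_b n) (beta_b n) (model n) (ltn0Sn n) (mN n)).1.
have EZ n : Ex Pr (Z n) <= 2 * deviation_bound lo hi / n.+1%:R ^+ 2.
  exact: (fluctuation_moments lo0 (phi_b n) (phis_b n) (beta_b n) (model n) (ltn0Sn n) (mN n)).2.
have Z0 n w : 0 <= Z n w by exact: fluctuation_ge0.
have ag n : all_moments Pr (g n).
  exact: (sinr_moments lo0 (phi_b n) (beta_b n) (model n)).
pose delta := 1 - r; pose c := lo * delta / hi.
have d0 : 0 < delta by rewrite subr_gt0.
pose A (eps : R) := eps ^- 3 + hi / lo * (16 / c ^+ 4).
pose A' := hi / lo * (2 / c + hi / lo / c).
(* The threshold on [n] comes only from the bound on [K n / n.+1], so one threshold serves all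
   outcomes [w] and the inequality can be integrated. *)
have gap : forall eps : R, 0 < eps -> \forall n \near \oo, forall w,
    `|g n w - gbar n| / n.+1%:R <= eps + A eps * Z n w + A' * n.+1%:R^-1.
  move=> eps eps0; apply: filterS Kr => n Kn w; have [gb0 gbE] := gbarP n.
  apply: sinr_gap => //.
  have : (K n).-1%:R <= (K n)%:R :> R by rewrite ler_nat leq_pred.
  by rewrite /delta; move: Kn; lra.
have ERe n : ('E_Pr[fun w => complex.Re (gamma n w)] = (Ex Pr (g n))%:E)%E.
  by rewrite unlock -EFin_Ex//; apply: eq_integral => w _; rewrite gE.
have EIm n : ('E_Pr[fun w => complex.Im (gamma n w)] = 0)%E.
  by rewrite unlock; apply: integral0_eq => w _; rewrite gE.
split; [|split; [|split]].
- apply: filterS (ae_cvg0_summable aZ Z0 EZ) => w Zw.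
  apply: cvg0_epsilon_bound Zw _ => eps /gap; apply: filterS => n /(_ w) h.
  apply: le_trans h; rewrite gE -rmorphB /cmod /= expr0n addr0 sqrtr_sqr.
  by rewrite normrM normr_id normfV (ger0_norm (ler0n _ _)).
- by move=> n; rewrite ERe EIm.
- have EZ0 : (fun n => Ex Pr (Z n)) @ \oo --> (0 : R).
    apply: (@squeeze_cvgr _ _ _ _ (fun=> 0) (fun n => 2 * deviation_bound lo hi * harmonic n)).
    + apply: nearW => n; rewrite Ex_ge0//=; apply: le_trans (EZ n) _.
      have B0 : 0 <= 2 * deviation_bound lo hi.
        have := le_trans (Ex_ge0 Pr (Z0 0%N)) (EZ 0%N).
        by rewrite expr1n divr1.
      apply: ler_wpM2l => //; rewrite lef_pV2 ?posrE ?exprn_gt0 ?ltr0n//.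
      by rewrite -natrX ler_nat expnS expn1 leq_pmulr.
    + exact: cvg_cst.
    + rewrite -[X in _ --> X](mulr0 (2 * deviation_bound lo hi)).
      by apply: cvgM; [exact: cvg_cst|exact: cvg_harmonic].
  apply: (cvg0_epsilon_bound (A := A) (A' := A') EZ0) => eps eps0.
  apply: filterS (gap eps eps0) => n h.
  rewrite ERe /= normrM normfV (ger0_norm (ler0n _ _)) ler_pdivrMr ?ltr0n//.
  set C := (X in _ <= X); have nN : n.+1%:R != 0 :> R by rewrite pnatr_eq0.
  have aC : all_moments Pr (fun w => eps * n.+1%:R + A' + A eps * n.+1%:R * Z n w).
    by apply: all_momentsD; [exact: all_moments_cst|exact: all_momentsZ].
  (* Writing the deterministic bound as a mean reduces the claim to the pointwise inequality
     [hw]. *)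
  have CE : C = Ex Pr (fun w => eps * n.+1%:R + A' + A eps * n.+1%:R * Z n w).
    rewrite ExD; [|exact: all_moments_cst|exact: all_momentsZ].
    by rewrite Ex_cst ExZ// /C; move: (n.+1%:R) nN => q q0; field.
  have hw w : `|g n w - gbar n| <= eps * n.+1%:R + A' + A eps * n.+1%:R * Z n w.
    have := h w; rewrite ler_pdivrMr ?ltr0n// => h'; apply: le_trans h' _.
    by rewrite le_eqVlt; apply/orP; left; apply/eqP; move: (n.+1%:R) nN => q q0; field.
  have agb : all_moments Pr (fun w => g n w - gbar n).
    by apply: all_momentsB => //; exact: all_moments_cst.
  have -> : Ex Pr (g n) - gbar n = Ex Pr (fun w => g n w - gbar n).
    by rewrite ExB// ?Ex_cst//; exact: all_moments_cst.
  rewrite CE ler_norml; apply/andP; split.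
    rewrite lerNl -mulN1r -ExZ//; apply: Ex_le => //; first exact: all_momentsZ.
    by move=> w; rewrite mulN1r; apply: le_trans (hw w); rewrite -normrN ler_norm.
  by apply: Ex_le => // w; apply: le_trans (hw w); exact: ler_norm.
- rewrite (_ : (fun n => _) = (fun=> 0)); first exact: cvg_cst.
  by apply/funext => n; rewrite EIm mul0r.
Qed.
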